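(* Let $p\in[1,+\infty]$, let $\Sigma_0,\Sigma_1$ be two subsets of $\mathbb R^2$, and let $S_i:\mathbb R\rightrightarrows\mathbb R$ be the set-valued map whose graph is equal to $R\Sigma_i$ for $i\in\{0,1\}$. Define the set-valued map $S$ on $\mathbb R^2$ which associates with every $(x,y)\in\mathbb R^2$ the Cartesian product $(-S_1)(y)\times(-S_0)(x)$. (a) Let $z$ be a solution in $\mathsf X_p$ of the two-boundary wave equation associated with $(\Sigma_0,\Sigma_1)$ with initial condition $(z_0,z_1)\in\mathsf X_p$, let $f\in L^p_{\mathrm{loc}}(0,+\infty)$ and $g\in L^p_{\mathrm{loc}}(-1,+\infty)$ be the corresponding functions in the definition of solution, and let $(h_n)_{n\in\mathbb N}=\mathrm{Seq}_0(f(\cdot+1))$ and $(g_n)_{n\in\mathbb N}=\mathrm{Seq}_0(g)$. Then $(h_n,g_n)_{n\in\mathbb N}$ is an iterated sequence for $S$ on $\mathsf Z_p\times\mathsf Z_p$ starting at $(h_0,g_0)=\mathfrak I_2(z_0,z_1)$. (b) Conversely, let $(h_n,g_n)_{n\in\mathbb N}$ be an iterated sequence for $S$ on $\mathsf Z_p\times\mathsf Z_p$ starting at some $(h_0,g_0)\in\mathsf Z_p\times\mathsf Z_p$. Let $f(\cdot+1)=\mathrm{Seq}_0^{-1}((h_n)_{n\in\mathbb N})$ and $g=\mathrm{Seq}_0^{-1}((g_n)_{n\in\mathbb N})$. Then $f\in L^p_{\mathrm{loc}}(0,+\infty)$, $g\in L^p_{\mathrm{loc}}(-1,+\infty)$ and,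 if $z(t,x)=\frac1{\sqrt2}\int_0^{t+x}f(s)\,ds+\frac1{\sqrt2}\int_0^{t-x}g(s)\,ds$, then $z$ is a solution in $\mathsf X_p$ of the two-boundary wave equation associated with $(\Sigma_0,\Sigma_1)$ with initial condition $(z_0,z_1)=\mathfrak I_2^{-1}(h_0,g_0)$. (c) Let $z,f,g$ and $(h_n,g_n)_{n\in\mathbb N}$ be as in (a) or (b). Then, for all $t\in\mathbb R_+$, $e_p^p(z)(t)=\|f(t+1+\cdot)\|_{\mathsf Z_p}^p+\|g(t+\cdot)\|_{\mathsf Z_p}^p$ if $p<+\infty$, and $e_\infty(z)(t)=\max(\|f(t+1+\cdot)\|_{\mathsf Z_\infty},\|g(t+\cdot)\|_{\mathsf Z_\infty})$. In particular, for all $n\in\mathbb N$, $e_p^p(z)(n)=\|h_n\|_{\mathsf Z_p}^p+\|g_n\|_{\mathsf Z_p}^p$ if $p<+\infty$, and $e_\infty(z)(n)=\max(\|h_n\|_{\mathsf Z_\infty},\|g_n\|_{\mathsf Z_\infty})$.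
   Context: Notation: $\mathbb R_+=[0,+\infty)$, $\mathbb N=\{0,1,2,\dots\}$, $R=\begin{pmatrix}\frac1{\sqrt2}&\frac1{\sqrt2}\\-\frac1{\sqrt2}&\frac1{\sqrt2}\end{pmatrix}$, $R\Sigma_i=\{R\xi:\xi\in\Sigma_i\}$. The graph of a set-valued map $F:\mathbb R\rightrightarrows\mathbb R$ is $\{(x,y):y\in F(x)\}$ (values may be empty), and $(-F)(x)=\{-y:y\in F(x)\}$. $L^p_{\mathrm{loc}}(a,+\infty)$ is the set of measurable functions whose restriction to $(a,T)$ is in $L^p$ for every $T>a$. $W^{1,p}_*(0,1)=\{u\in L^p(0,1): u'\in L^p(0,1),\ u(0)=0\}$, $\mathsf X_p=W^{1,p}_*(0,1)\times L^p(0,1)$, $\mathsf Z_p=L^p(-1,0)$. For $(u,v)$ with $u',v\in L^p(0,1)$ write $\|(u,v)\|_{\mathsf X_p}^p=2^{-p/2}\int_0^1(|u'+v|^p+|u'-v|^p)\,dx$ if $p<+\infty$ and $\|(u,v)\|_{\mathsf X_\infty}=\frac1{\sqrt2}\max(\|u'+v\|_{L^\infty(0,1)},\|u'-v\|_{L^\infty(0,1)})$. The two-boundary wave equation associated with $(\Sigma_0,\Sigma_1)$ is: $z_{tt}=z_{xx}$ on $\mathbb R_+\times[0,1]$; $(z_t(t,0),z_x(t,0))\in\Sigma_0$ and $(z_t(t,1),-z_x(t,1))\in\Sigma_1$ for $t\in\mathbb R_+$; $z(0,x)=z_0(x)$, $z_t(0,x)=z_1(x)$ for $x\in[0,1]$.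 A solution in $\mathsf X_p$ with initial condition $(z_0,z_1)\in\mathsf X_p$ (so that $z(0,0)=z_0(0)=0$) is a function $z:\mathbb R_+\times[0,1]\to\mathbb R$ for which there exist $f\in L^p_{\mathrm{loc}}(0,+\infty)$ and $g\in L^p_{\mathrm{loc}}(-1,+\infty)$ such that $z(t,x)=\frac1{\sqrt2}\int_0^{t+x}f+\frac1{\sqrt2}\int_0^{t-x}g$ for all $(t,x)$, the two boundary inclusions hold for a.e. $t\in\mathbb R_+$, and $z(0,x)=z_0(x)$, $z_t(0,x)=z_1(x)$ for a.e. $x\in[0,1]$; here $z_t(t,x)=\frac{f(t+x)+g(t-x)}{\sqrt2}$ and $z_x(t,x)=\frac{f(t+x)-g(t-x)}{\sqrt2}$. Set $e_p(z)(t)=\|(z(t,\cdot),z_t(t,\cdot))\|_{\mathsf X_p}$ (an expression depending only on $z_x(t,\cdot)$ and $z_t(t,\cdot)$). An iterated sequence for $S$ on $\mathsf Z_p\times\mathsf Z_p$ is a sequence $(h_n,g_n)_{n\in\mathbb N}$ in $\mathsf Z_p\times\mathsf Z_p$ with $(h_{n+1}(s),g_{n+1}(s))\in S(h_n(s),g_n(s))$ for every $n\in\mathbb N$ and a.e. $s\in[-1,0]$. $\mathrm{Seq}_0:L^p_{\mathrm{loc}}(-1,+\infty)\to\mathsf Z_p^{\mathbb N}$ is the bijection $h\mapsto(h_n)_{n\in\mathbb N}$ with $h_n(s)=h(s+n)$ for a.e. $s\in[-1,0]$. $\mathfrak I_2:\mathsf X_p\to\mathsf Z_p\times\mathsf Z_p$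 is the isometry mapping $(z_0,z_1)$ to $(h_0,g_0)$ defined by $\begin{pmatrix}g_0(-s)\\-h_0(s-1)\end{pmatrix}=R\begin{pmatrix}z_1(s)\\-z_0'(s)\end{pmatrix}$ for a.e. $s\in[0,1]$. *)

(* Defs.v *)
From HB Require Import structures.
From mathcomp Require Import all_boot all_order all_algebra.
From mathcomp Require Import all_classical all_reals all_analysis.

Set Implicit Arguments.
Unset Strict Implicit.
Unset Printing Implicit Defensive.

Import Order.TTheory GRing.Theory Num.Theory.
Import numFieldNormedType.Exports.

Local Open Scope classical_set_scope.
Local Open Scope ring_scope.

(* Elements of the Lebesgue spaces are represented by everywhere-defined
   functions R -> R; values outside the domain under consideration are
   irrelevant, and equality in these spaces is almost-everywhere equality on
   the domain. *)

Section lebesgue_spaces.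
Context {R : realType}.
Notation mu := (@lebesgue_measure R).
Implicit Types (p : \bar R) (D : set R) (f : R -> R).

(* As f \_ D vanishes outside D, this is the norm of L^p(D), also when
   p = +oo. *)
Definition Lp_norm p D f : \bar R := 'N[mu]_p[EFin \o (f \_ D)]%E.

Definition Lp p D f : Prop := (f \_ D) \in Lfun mu p.

Definition Lp_loc p (a : R) f : Prop :=
  measurable_fun `]a, +oo[ f /\ forall T, a < T -> Lp p `]a, T[ f.

Definition in_Zp p f : Prop := Lp p `]-1, 0[ f.

Definition Zp_norm p f : \bar R := Lp_norm p `]-1, 0[ f.

Definition oint (a b : R) f : R :=
  if a <= b then \int[mu]_(x in `[a, b]) f x
  else - \int[mu]_(x in `[b, a]) f x.

End lebesgue_spaces.

Section sobolev.
Context {R : realType}.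
Notation mu := (@lebesgue_measure R).
Implicit Types (p : \bar R) (u du v : R -> R).

(* C^1 (rather than smooth) functions with compact support in (0,1) are the
   test functions for weak derivatives. *)
Definition test_function (phi : R -> R) : Prop :=
  [/\ forall x, derivable phi x 1,
      continuous (derive1 phi) &
      exists K : set R, [/\ compact K, K `<=` `]0, 1[ &
                            forall x, ~ K x -> phi x = 0]].

Definition weak_derivative u du : Prop :=
  [/\ locally_integrable `]0, 1[ u, locally_integrable `]0, 1[ du &
      forall phi, test_function phi ->
        \int[mu]_(x in `]0, 1[) (u x * derive1 phi x) =
        - \int[mu]_(x in `]0, 1[) (du x * phi x)].

(* u is an almost-everywhere class, so the condition u(0) = 0 is about its
   continuous representative on [0,1]. *)
Definition vanishes_at_0 u : Prop :=
  exists v, [/\ {within `[0, 1], continuous v},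
                v = u %[ae mu in `]0, 1[%classic] & v 0 = 0].

Definition in_W1p_star p u : Prop :=
  [/\ Lp p `]0, 1[ u,
      exists2 du, weak_derivative u du & Lp p `]0, 1[ du &
      vanishes_at_0 u].

Definition in_Xp p u v : Prop := in_W1p_star p u /\ Lp p `]0, 1[ v.

(* The norm of (u, v) as a function of du = u' and v; the value at p = -oo is
   a dummy. *)
Definition Xp_norm p du v : \bar R :=
  match p with
  | r%:E => (((2 `^ (- (r / 2)))%R%:E *
      \int[mu]_(x in `]0%R, 1%R[)
        ((`|du x + v x| `^ r + `|du x - v x| `^ r)%R)%:E) `^ r^-1)%E
  | +oo%E => ((Num.sqrt 2)^-1%R%:E *
      maxe (Lp_norm +oo `]0%R, 1%R[ (du \+ v)%R)
           (Lp_norm +oo `]0%R, 1%R[ (du \- v)%R))%E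
  | -oo%E => 0%E
  end.

End sobolev.

Section wave_equation.
Context {R : realType}.
Notation mu := (@lebesgue_measure R).
Implicit Types (p : \bar R) (f g : R -> R) (z : R -> R -> R).

(* The linear map of matrix (1/sqrt 2) [[1, 1], [-1, 1]]. *)
Definition rotR (xi : R * R) : R * R :=
  ((xi.1 + xi.2) / Num.sqrt 2, (- xi.1 + xi.2) / Num.sqrt 2).

(* Functions on R_+ * [0,1] are represented by z : R -> R -> R, only the
   values z t x with 0 <= t and 0 <= x <= 1 being relevant. *)
Definition dalembert f g z : Prop :=
  forall t x, 0 <= t -> 0 <= x <= 1 ->
    z t x = (Num.sqrt 2)^-1 * oint 0 (t + x) f
          + (Num.sqrt 2)^-1 * oint 0 (t - x) g.

(* z_t and z_x in terms of the functions f and g associated with z. *)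
Definition wave_t f g (t x : R) : R := (f (t + x) + g (t - x)) / Num.sqrt 2.

Definition wave_x f g (t x : R) : R := (f (t + x) - g (t - x)) / Num.sqrt 2.

Definition solution_with p (Sigma0 Sigma1 : set (R * R)) (z0 z1 : R -> R)
    z f g : Prop :=
  [/\ Lp_loc p 0 f /\ Lp_loc p (-1) g,
      dalembert f g z,
      \forall t \ae mu, 0 <= t -> Sigma0 (wave_t f g t 0, wave_x f g t 0),
      \forall t \ae mu, 0 <= t -> Sigma1 (wave_t f g t 1, - wave_x f g t 1) &
      z 0 = z0 %[ae mu in `[0, 1]%classic] /\
      wave_t f g 0 = z1 %[ae mu in `[0, 1]%classic]].

Definition solution p (Sigma0 Sigma1 : set (R * R)) (z0 z1 : R -> R) z : Prop :=
  exists f g, solution_with p Sigma0 Sigma1 z0 z1 z f g.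

(* A choice of functions f and g associated with z; they are determined by z
   up to almost-everywhere equality. *)
Definition profiles p z : (R -> R) * (R -> R) :=
  get [set fg | [/\ Lp_loc p 0 fg.1, Lp_loc p (-1) fg.2 &
                    dalembert fg.1 fg.2 z]].

(* The norm in X_p of (z(t,.), z_t(t,.)), which involves z only through z_x
   and z_t. *)
Definition energy p z (t : R) : \bar R :=
  let: (f, g) := profiles p z in Xp_norm p (wave_x f g t) (wave_t f g t).

End wave_equation.

Section set_valued_maps.
Context {R : realType}.
Notation mu := (@lebesgue_measure R).
Implicit Types (p : \bar R) (F : R -> set R).

Definition set_graph F : set (R * R) := [set xy | F xy.1 xy.2].

Definition opp_map F : R -> set R := fun x => [set - y | y in F x].

Definition iterated_sequence p (S : R * R -> set (R * R))
    (h g : nat -> R -> R) : Prop :=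
  (forall n, in_Zp p (h n) /\ in_Zp p (g n)) /\
  (forall n, \forall s \ae mu, `[-1, 0]%classic s ->
     S (h n s, g n s) (h n.+1 s, g n.+1 s)).

Definition Seq0 (h : R -> R) : nat -> R -> R := fun n s => h (s + n%:R).

(* h is (a representative of) the preimage under Seq0 of the sequence hn. *)
Definition is_Seq0_inv p (hn : nat -> R -> R) (h : R -> R) : Prop :=
  Lp_loc p (-1) h /\ forall n, Seq0 h n = hn n %[ae mu in `[-1, 0]%classic].

(* (h0, g0) is the image of (z0, z1); the weak derivative dz0 of z0 is unique
   up to almost-everywhere equality. *)
Definition is_I2 (z0 z1 h0 g0 : R -> R) : Prop :=
  exists2 dz0, weak_derivative z0 dz0 &
    \forall s \ae mu, `[0, 1]%classic s ->
      (g0 (- s), - h0 (s - 1)) = rotR (z1 s, - dz0 s).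

End set_valued_maps.

(* Main.v *)
Require Import Defs.
From HB Require Import structures.
From mathcomp Require Import all_boot all_order all_algebra.
From mathcomp Require Import all_classical all_reals all_analysis.
From mathcomp Require Import measurable_realfun ess_sup_inf ring lra.

Set Implicit Arguments.
Unset Strict Implicit.
Unset Printing Implicit Defensive.

Import Order.TTheory GRing.Theory Num.Theory.
Import numFieldNormedType.Exports.

Local Open Scope classical_set_scope.
Local Open Scope ring_scope.

(** In the characteristic coordinates a solution is a sum of two travelling
    waves, z_t + z_x carrying f(t + x) and z_t - z_x carrying g(t - x), so the
    wave equation itself is already solved by the pair (f, g) and only the
    boundary conditions remain.  The rotation R is exactly the passage from
    (z_t, z_x) to the travelling waves: the condition at x = 0 reads
    -g(t) \in S0 (f(t)) and the condition at x = 1 reads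
    -f(t + 1) \in S1 (g(t - 1)).  Both together say that one step of S leads
    from (f(t), g(t - 1)) to (f(t + 1), g(t)), which is [boundary_step].
    Cutting the time axis into windows of length one turns this into an
    iteration of S on pairs of functions on [-1, 0]; a.e. statements and norms
    pass between windows because translations and reflections preserve the
    Lebesgue measure.

    Three points need an actual argument from analysis.

    The initial data.  The map from (z0, z1) to the first window is expressed
    through the weak derivative of z0, whereas the d'Alembert formula at t = 0
    gives z(0, .) as the primitive of [wave_x f g 0] ([dalembert0]).  From a
    solution to the iteration, one needs that an integrable function is the
    weak derivative of its primitive, which is Fubini's theorem on a triangle
    ([Rintegral_triangle], [weak_derivative_primitive]).  In the other direction
    one needs that a continuous function on [0, 1] is determined by its weak
    derivative and its value at 0, which is the du Bois-Reymond lemma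
    ([du_bois_reymond], [weak_derivative_vanishes_unique]).

    The energy.  It is defined from z by choosing some pair of profiles, so
    one has to know that z determines f and g almost everywhere
    ([profiles_unique]).  If two pairs give the same z, then the differences A,
    B of the primitives satisfy A(u) + B(v) = 0 as long as 0 <= u + v and
    0 <= u - v <= 2; this forces A and B to vanish, and the Lebesgue
    differentiation theorem concludes.  The energy formula is then the
    identity u' + v = sqrt 2 f, u' - v = - sqrt 2 g ([Xp_norm_characteristics]),
    transported to the window [-1, 0].

    The existence of f and g for a given iterated sequence: the windows are
    glued, and on each bounded interval the result is a finite sum of functions
    of L^p ([Lp_glue]). *)

(** * Measure-preserving changes of variable *)

Section almost_everywhere.
Context {R : realType}.
Notation mu := (@lebesgue_measure R).
Implicit Types P Q S : R -> Prop.

Lemma ae_imp P Q : {ae mu, forall x, P x} -> (forall x, P x -> Q x) ->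
  {ae mu, forall x, Q x}.
Proof.
by move=> aeP PQ; apply: (@filterS _ _ (ae_filter_ringOfSetsType mu) P).
Qed.

Lemma ae_imp2 P Q S : {ae mu, forall x, P x} -> {ae mu, forall x, Q x} ->
  (forall x, P x -> Q x -> S x) -> {ae mu, forall x, S x}.
Proof.
by move=> aeP aeQ PQ; apply: (@filterS2 _ _ (ae_filter_ringOfSetsType mu) P Q).
Qed.

Lemma ae_neq (c : R) : {ae mu, forall x : R, x <> c}.
Proof.
exists [set c]; split => //; first exact: lebesgue_measure_set1.
by move=> x /= /contrapT.
Qed.

End almost_everywhere.

Section measure_preserving.
Context {R : realType}.
Notation mu := (@lebesgue_measure R).
Implicit Types (T : R -> R) (D : set R).

Definition measure_preserving T :=
  measurable_fun [set: R] T /\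
  forall A, measurable A -> mu (T @^-1` A) = mu A.

Lemma measurable_preimage T D : measure_preserving T -> measurable D ->
  measurable (T @^-1` D).
Proof. by move=> [mT _] mD; rewrite -[X in measurable X]setTI; exact: mT. Qed.

Lemma measure_preserving_shift (c : R) : measure_preserving (fun x => c + x).
Proof.
have mT : measurable_fun [set: R] (fun x : R => c + x) by exact: measurable_funD.
split => // A mA.
rewrite -[LHS]/(pushforward mu ((fun x : R => c + x) : _ -> measurableTypeR R) A).
apply/esym/lebesgue_measure_unique => //= _ [[a b]] _ <-; rewrite /pushforward.
have -> : (fun x : R => c + x) @^-1` `]a, b] = `]a - c, b - c]%classic.
  by apply/seteqP; split => x /=; rewrite !in_itv/= ltrBlDl lerBrDl.
rewrite !lebesgue_measure_itv/= !lte_fin ltrD2r.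
by case: ifP => // _; rewrite -!EFinD; congr EFin; ring.
Qed.

Lemma measure_preserving_reflect (c : R) : measure_preserving (fun x => c - x).
Proof.
have mT : measurable_fun [set: R] (fun x : R => c - x) by exact: measurable_funB.
split => // A mA.
have mcA := measurable_preimage (measure_preserving_shift c) mA.
rewrite -[RHS](measure_preserving_shift c).2//.
by rewrite -[RHS]lebesgue_measureN.
Qed.

(** Null sets pull back to null sets; every transfer of an a.e. property from one
    time window to another goes through this. *)
Lemma measure_preserving_ae T (P : R -> Prop) : measure_preserving T ->
  {ae mu, forall x, P x} -> {ae mu, forall x, P (T x)}.
Proof.
move=> Tmp [N [mN N0 PN]]; exists (T @^-1` N); split.
- exact: measurable_preimage.
- by rewrite (Tmp.2 _ mN).
- by move=> x /= nP; exact: PN.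
Qed.

Lemma ae_shift (c : R) (P : R -> Prop) :
  {ae mu, forall x, P x} -> {ae mu, forall x, P (c + x)}.
Proof. exact: measure_preserving_ae (measure_preserving_shift c). Qed.

Local Open Scope ereal_scope.

Lemma ge0_integral_comp T D (F : R -> \bar R) : measure_preserving T ->
  measurable D -> measurable_fun D F -> (forall x, D x -> 0 <= F x) ->
  \int[mu]_(x in T @^-1` D) F (T x) = \int[mu]_(x in D) F x.
Proof.
move=> Tmp mD mF F0.
have F0' : {in D, forall y, 0 <= F y} by move=> y /[!inE]; exact: F0.
have := @ge0_integral_pushforward _ _ (measurableTypeR R) (measurableTypeR R) R
  T Tmp.1 mu D F mD mF F0'.
move=> <-; apply: eq_measure_integral; first exact: Tmp.1.
move=> ? A mA _.
by rewrite -[RHS](Tmp.2 _ mA).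
Qed.

Lemma ge0_integralT_comp T (F : R -> \bar R) : measure_preserving T ->
  measurable_fun [set: R] F -> (forall x, 0 <= F x) ->
  \int[mu]_x F (T x) = \int[mu]_x F x.
Proof.
move=> Tmp mF F0; have := @ge0_integral_comp T setT F Tmp measurableT mF.
by rewrite preimage_setT => ->.
Qed.

(** Measurability of the integrand suffices: the integral is the difference of
    the integrals of the positive and negative parts, whether or not they are
    finite. *)
Lemma integralT_comp T (f : R -> R) : measure_preserving T ->
  measurable_fun [set: R] f ->
  \int[mu]_x (f (T x))%:E = \int[mu]_x (f x)%:E.
Proof.
move=> Tmp mf; have mEf : measurable_fun [set: R] (EFin \o f) by exact/measurable_EFinP.
rewrite -[LHS]/(\int[mu]_x ((EFin \o f) \o T) x).
rewrite integralE [in RHS]integralE; congr (_ - _).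
- under eq_integral do rewrite (funepos_comp (EFin \o f) T).
  by apply: (ge0_integralT_comp (F := (EFin \o f)^\+)) => //; exact: measurable_funepos.
- under eq_integral do rewrite (funeneg_comp (EFin \o f) T).
  by apply: (ge0_integralT_comp (F := (EFin \o f)^\-)) => //; exact: measurable_funeneg.
Qed.

(** For p = +oo the essential supremum depends only on the measures of the
    superlevel sets, which the change of variable preserves. *)
Lemma Lnorm_comp T p (F : R -> \bar R) : measure_preserving T ->
  p != -oo -> measurable_fun [set: R] F ->
  'N[mu]_p[F \o T] = 'N[mu]_p[F].
Proof.
move=> Tmp; rewrite unlock; case: p => [r _ mF|_ mF|//].
- congr (_ `^ _).
  rewrite -[RHS](@ge0_integralT_comp T _ Tmp)//.
    apply: (measurableT_comp (measurable_poweR _)) => //.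
    exact: measurableT_comp.
  by move=> x; exact: poweR_ge0.
- case: ifPn => // _.
  have mF' : measurable_fun [set: R] (abse \o F) by exact: measurableT_comp.
  have mFT : measurable_fun [set: R] (abse \o F \o T).
    by apply: measurableT_comp mF' _; exact: Tmp.1.
  rewrite !ess_supEmu0//.
  have muE y : mu ((abse \o (F \o T)) @^-1` `]y, +oo[) =
               mu ((abse \o F) @^-1` `]y, +oo[).
    rewrite -[RHS]Tmp.2// -[X in measurable X]setTI.
    by apply: mF' => //; exact: emeasurable_itv.
  by congr ereal_inf; apply/seteqP; split => y /=; rewrite muE.
Qed.

End measure_preserving.

(** * Functions of class L^p on a domain *)

Section Lp_domains.
Context {R : realType}.
Notation mu := (@lebesgue_measure R).
Implicit Types (T f g : R -> R) (D : set R) (p : \bar R).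
Local Open Scope ereal_scope.

(** Used twice in opposite directions, this makes the norm depend only on the
    a.e. class; applied to a restriction, it makes the norm monotone in the
    domain. *)
Lemma le_ae_Lnorm p (F G : R -> \bar R) : 1 <= p ->
  measurable_fun [set: R] F -> measurable_fun [set: R] G ->
  {ae mu, forall x, `|F x| <= `|G x|} -> 'N[mu]_p[F] <= 'N[mu]_p[G].
Proof.
rewrite unlock; case: p => [r r1|_|//] mF mG FG.
- have r0 : (0 <= r)%R by rewrite (le_trans ler01)// -lee_fin.
  have mono (s : R) x y : (0 <= s)%R -> 0 <= x -> x <= y -> x `^ s <= y `^ s.
    move=> s0 x0 xy; apply: gt0_ler_poweR => //; rewrite in_itv/= leey andbT//.
    exact: le_trans xy.
  apply: (mono); first by rewrite invr_ge0.
    by apply: integral_ge0 => x _; exact: poweR_ge0.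
  apply: ae_ge0_le_integral => //.
  + by move=> x _; exact: poweR_ge0.
  + apply: (measurableT_comp (measurable_poweR _)) => //.
    exact: measurableT_comp.
  + by move=> x _; exact: poweR_ge0.
  + apply: (measurableT_comp (measurable_poweR _)) => //.
    exact: measurableT_comp.
  + by apply: (ae_imp FG) => x FGx _; exact: mono.
- by case: ifPn => // _; exact: le_ess_sup.
Qed.

Lemma LpP p D f : Lp p D f <->
  measurable_fun [set: R] (f \_ D) /\ Lp_norm p D f < +oo.
Proof.
rewrite /Lp; split; first by move=> /andP[]; rewrite !inE.
by move=> [mf nf]; apply/andP; split; rewrite inE.
Qed.

Lemma Lp_measurable p D f : Lp p D f -> measurable_fun [set: R] (f \_ D).
Proof. by case/LpP. Qed.

Lemma Lp_measurable_fun p D f : measurable D -> Lp p D f -> measurable_fun D f.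
Proof. by move=> mD /Lp_measurable /(measurable_restrictT _ mD). Qed.

Lemma eq_in_Lp p (D : set R) f g : (forall x, D x -> f x = g x) ->
  Lp p D f -> Lp p D g.
Proof.
move=> fg; rewrite /Lp (_ : f \_ D = g \_ D)//.
by apply/funext => x; rewrite !patchE; case: ifPn => // /set_mem /fg.
Qed.

Lemma eq_ae_Lp_norm p D f g : 1 <= p ->
  measurable_fun [set: R] (f \_ D) -> measurable_fun [set: R] (g \_ D) ->
  f = g %[ae mu in D] -> Lp_norm p D f = Lp_norm p D g.
Proof.
move=> p1 mf mg fg; have fg' : {ae mu, forall x, (f \_ D) x = (g \_ D) x}.
  apply: (ae_imp fg) => x fgx; rewrite !patchE; case: ifPn => // xD.
  by apply: fgx; exact: set_mem.
apply/eqP; rewrite eq_le; apply/andP; split;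
  apply: le_ae_Lnorm => //; try exact/measurable_EFinP;
  by apply: (ae_imp fg') => x /= ->.
Qed.

Lemma Lp_subset p D D' f : 1 <= p -> measurable D' -> D' `<=` D ->
  Lp p D f -> Lp p D' f.
Proof.
move=> p1 mD' DD' /LpP[mf nf]; have E : f \_ D' = (f \_ D) \_ D'.
  apply/funext => x; rewrite !patchE; case: ifPn => // /set_mem xD.
  by rewrite mem_set//; exact: DD'.
have mf' : measurable_fun [set: R] (f \_ D').
  by rewrite E; apply/(measurable_restrictT _ mD'); exact: measurable_funTS.
apply/LpP; split => //; apply: le_lt_trans nf.
apply: le_ae_Lnorm => //; try exact/measurable_EFinP.
apply: aeW => x /=; rewrite !patchE; case: ifPn => [/set_mem xD|_].
  by rewrite mem_set//; exact: DD'.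
by rewrite normr0 lee_fin normr_ge0.
Qed.

(** Substitution commutes with the extension by 0 through which the norms on a
    domain are defined, so statements on the whole line yield those on domains. *)
Lemma restrict_comp T D f : (f \o T) \_ (T @^-1` D) = (f \_ D) \o T.
Proof.
apply/funext => x; rewrite /= !patchE; congr (if _ then _ else _).
Qed.

Lemma measurable_fun_comp_preserving (T : R -> R) (D : set R) f :
  measure_preserving T -> measurable D -> measurable_fun D f ->
  measurable_fun (T @^-1` D) (f \o T).
Proof.
move=> Tmp mD mf; have mTD := measurable_preimage Tmp mD.
apply/(measurable_restrictT _ mTD); rewrite restrict_comp.
by apply: measurableT_comp; [apply/(measurable_restrictT _ mD)|exact: Tmp.1].
Qed.

Lemma Lp_norm_comp p T D f : 1 <= p -> measure_preserving T ->
  measurable_fun [set: R] (f \_ D) ->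
  Lp_norm p (T @^-1` D) (f \o T) = Lp_norm p D f.
Proof.
move=> p1 Tmp mf; rewrite /Lp_norm restrict_comp.
apply: (Lnorm_comp (F := EFin \o (f \_ D))) => //; last exact/measurable_EFinP.
by apply: contraTneq p1 => ->.
Qed.

Lemma Lp_comp p T D f : 1 <= p -> measure_preserving T ->
  Lp p D f -> Lp p (T @^-1` D) (f \o T).
Proof.
move=> p1 Tmp /LpP[mf nf]; apply/LpP; split; last by rewrite Lp_norm_comp.
by rewrite restrict_comp; apply: measurableT_comp => //; exact: Tmp.1.
Qed.

(** For finite p this is the bound |f| <= 1 + |f|^p. *)
Lemma Lp_integrable p D f : 1 <= p -> measurable D -> mu D < +oo ->
  Lp p D f -> mu.-integrable D (EFin \o f).
Proof.
move=> p1 mD Doo Lf.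
have mf := Lp_measurable_fun mD Lf; have mF := Lp_measurable Lf.
have i1 M : mu.-integrable D (EFin \o cst M).
  apply/integrableP; split; first exact/measurable_EFinP.
  rewrite [ltLHS](_ : _ = \int[mu]_(x in D) (`|M|%R%:E)); last exact: eq_integral.
  by rewrite integral_cst// lte_mul_pinfty// lee_fin.
have fE x : D x -> f x = (f \_ D) x by move=> Dx; rewrite patchE mem_set.
case: p p1 Lf => [r r1 Lf|_ Lf|//].
- have iF := Lfun_integrable r1 Lf.
  have iD : mu.-integrable D (fun x => (1 + `|(f \_ D) x| `^ r)%:E).
    suff : mu.-integrable D
      ((EFin \o cst 1%R) \+ (fun x => (`|(f \_ D) x| `^ r)%:E)) by [].
    by apply: integrableD => //; exact: integrableS iF.
  apply: le_integrable iD => //; first exact/measurable_EFinP.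
  move=> x Dx /=; rewrite lee_fin fE// [leRHS]ger0_norm ?addr_ge0 ?powR_ge0//.
  (* below 1 the constant dominates, above 1 the power does *)
  have [x1|x1] := leP `|(f \_ D) x|%R 1%R.
    by rewrite (le_trans x1)// lerDl powR_ge0.
  rewrite -[leLHS]powRr1//; apply: (le_trans (y := (`|(f \_ D) x| `^ r)%R)).
    by apply: ler_powR => //; exact: ltW.
  by rewrite lerDr.
- have [_] := (LpP _ _ _).1 Lf.
  rewrite /Lp_norm unlock; case: ifPn => [_|T0 _]; last first.
    apply/integrableP; split; first exact/measurable_EFinP.
    suff -> : \int[mu]_(x in D) `|(EFin \o f) x| = 0 by [].
    have D0 : mu D = 0.
      apply/eqP; rewrite -measure_le0 leNgt; apply: contra T0 => D0.
      by rewrite (lt_le_trans D0)// le_measure// inE.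
    apply: null_set_integral => //; apply: measurableT_comp => //.
    exact/measurable_EFinP.
  move=> /ess_supr_bounded[M fM].
  apply/integrableP; split; first exact/measurable_EFinP.
  have /integrableP[_] := i1 M; apply: le_lt_trans.
  apply: ae_ge0_le_integral => //.
  + by apply: measurableT_comp => //; exact/measurable_EFinP.
  + exact: (measurable_cst `|M|%R%:E).
  + apply: (ae_imp fM) => x {}fM Dx /=; rewrite lee_fin fE// (le_trans fM)//.
    exact: ler_norm.
Qed.

Lemma Lp_lin p D f g (a b : R) : 1 <= p ->
  Lp p D f -> Lp p D g -> Lp p D (fun x => a * f x + b * g x)%R.
Proof.
move=> p1 Lf Lg; rewrite /Lp.
have -> : (fun x => a * f x + b * g x)%R \_ D = (a *: (f \_ D) + b *: (g \_ D))%R.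
  apply/funext => x; rewrite !fctE !patchE.
  by case: ifPn => //; rewrite !scaler0 addr0.
have [_ H] := @Lfun_submod_closed _ _ R mu p p1.
apply: (H a) => //; have [H0 _] := @Lfun_submod_closed _ _ R mu p p1.
by rewrite -[X in X \in _]addr0; apply: (H b).
Qed.

Lemma bounded_Lp p D f (M : R) : 1 <= p -> measurable D -> mu D < +oo ->
  measurable_fun D f -> (forall x, D x -> `|f x| <= M)%R -> Lp p D f.
Proof.
move=> p1 mD Doo mf fM; apply/LpP.
have mF : measurable_fun [set: R] (f \_ D) by exact/(measurable_restrictT _ mD).
split => //; rewrite /Lp_norm unlock; case: p p1 => [r r1|_|//].
- have r0 : (0 < r)%R by rewrite (lt_le_trans ltr01)// -lee_fin.
  rewrite poweR_lty//.
  have : \int[mu]_(x in D) ((`|M| `^ r)%R%:E) < +oo.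
    by rewrite integral_cst// lte_mul_pinfty// lee_fin powR_ge0.
  rewrite [in X in X -> _]integral_mkcond; apply: le_lt_trans; apply: ge0_le_integral => //.
  + by move=> x _; exact: poweR_ge0.
  + apply: (measurableT_comp (measurable_poweR _)) => //.
    by apply: measurableT_comp => //; exact/measurable_EFinP.
  + by apply/(measurable_restrictT _ mD); exact: measurable_cst.
  + move=> x _ /=; rewrite !patchE; case: ifPn => [/set_mem Dx|_].
      rewrite lee_fin; apply: ge0_ler_powR; rewrite ?nnegrE//.
        exact: ltW.
      by rewrite (le_trans (fM _ Dx))// ler_norm.
    by rewrite normr0 powR0// gt_eqF.
- case: ifPn => // _; apply: (@le_lt_trans _ _ `|M|%:E); last exact: ltry.
  apply/ess_supP/aeW => x /=; rewrite patchE lee_fin.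
  case: ifPn => [/set_mem Dx|_]; last by rewrite normr0.
  by rewrite (le_trans (fM _ Dx))// ler_norm.
Qed.

End Lp_domains.

(** * Primitives and weak derivatives *)

Section primitives.
Context {R : realType}.
Notation mu := (@lebesgue_measure R).
Implicit Types (f g w k phi : R -> R) (D : set R).

Lemma EFin_Rintegral D f : measurable D -> mu.-integrable D (EFin \o f) ->
  ((\int[mu]_(x in D) f x)%:E = \int[mu]_(x in D) (f x)%:E)%E.
Proof. by move=> mD fi; rewrite fineK//; exact: integrable_fin_num. Qed.

(** Both sides are iterated integrals of w(y) k(x) over the half plane y <= x;
    the kernel is integrable on the plane, being dominated by |w(y)| |k(x)|. *)
Lemma Rintegral_triangle w k :
  mu.-integrable [set: R] (EFin \o w) -> mu.-integrable [set: R] (EFin \o k) ->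
  \int[mu]_x ((\int[mu]_(y in `]-oo, x]) w y) * k x) =
  \int[mu]_y (w y * (\int[mu]_(x in `[y, +oo[) k x)).
Proof.
move=> iw ik.
have mw : measurable_fun [set: R] w.
  by apply/measurable_EFinP; exact: measurable_int iw.
have mk : measurable_fun [set: R] k.
  by apply/measurable_EFinP; exact: measurable_int ik.
pose K (z : measurableTypeR R * measurableTypeR R) : R :=
  if z.2 <= z.1 then w z.2 * k z.1 else 0.
have mK : measurable_fun [set: measurableTypeR R * measurableTypeR R] (EFin \o K).
  apply/measurable_EFinP; apply: measurable_fun_ifT => //.
    exact: measurable_fun_ler.
  by apply: measurable_funM; apply: measurableT_comp.
have iK : (mu \x mu)%E.-integrable setT (EFin \o K).
  apply/integrable12ltyP => //=.
  have [C CE] : exists C, (\int[mu]_y `|w y|%:E = C%:E)%E.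
    exists (fine (\int[mu]_y `|w y|%:E)%E); rewrite fineK//.
    exact: (integrable_fin_num _ (integrable_abse iw)).
  have wk x : (\int[mu]_y (`|w y| * `|k x|)%:E = C%:E * `|k x|%:E)%E.
    under eq_integral do rewrite EFinM.
    by rewrite ge0_integralZr ?CE//; do 2 apply: measurableT_comp => //.
  apply: (@le_lt_trans _ _ (\int[mu]_x (C%:E * `|k x|%:E))%E).
    apply: ge0_le_integral => //.
    + by move=> x _; exact: integral_ge0.
    + apply: (measurable_fun_fubini_tonelli_F (abse \o (EFin \o K))).
        exact: measurableT_comp.
      by move=> z; exact: abse_ge0.
    + apply/measurable_EFinP; apply: measurable_funM => //.
      exact: measurableT_comp.
    + move=> x _; rewrite -wk; apply: ge0_le_integral => //.
      * apply/measurable_EFinP; apply: measurableT_comp => //.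
        by apply/measurable_EFinP; apply: (measurableT_comp mK).
      * apply/measurable_EFinP; apply: measurable_funM => //.
        exact: measurableT_comp.
      * move=> y _; rewrite lee_fin /K /=; case: ifPn => _.
          by rewrite normrM.
        by rewrite normr0 mulr_ge0.
  rewrite ge0_integralZl//.
  - rewrite lte_mul_pinfty// -?CE; first exact: integral_ge0.
    by have /integrableP[] := ik.
  - by do 2 apply: measurableT_comp => //.
  - by rewrite -CE; exact: integral_ge0.
have inner1 x : (\int[mu]_y (EFin \o K) (x, y) =
    (((\int[mu]_(y in `]-oo, x]) w y) * k x)%:E))%E.
  have iwx : mu.-integrable `]-oo, x] (EFin \o w) by exact: integrableS iw.
  rewrite EFinM EFin_Rintegral// -integralZr// [RHS]integral_mkcond.
  apply: eq_integral => y _; rewrite patchE /K/= mem_setE in_itv/=.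
  by case: ifPn.
have inner2 y : (\int[mu]_x (EFin \o K) (x, y) =
    ((w y * (\int[mu]_(x in `[y, +oo[) k x))%:E))%E.
  have ikx : mu.-integrable `[y, +oo[ (EFin \o k) by exact: integrableS ik.
  rewrite EFinM EFin_Rintegral// -integralZl// [RHS]integral_mkcond.
  apply: eq_integral => x _; rewrite patchE /K/= mem_setE in_itv/= andbT.
  by case: ifPn.
have := Fubini iK.
under eq_integral do rewrite inner1.
under [X in _ = X -> _]eq_integral do rewrite inner2.
by rewrite /Rintegral => ->.
Qed.

End primitives.

Section weak_derivatives.
Context {R : realType}.
Notation mu := (@lebesgue_measure R).
Implicit Types (f g h w k phi : R -> R) (D : set R).

Lemma lebesgue_measure_itvoo_lty (a b : R) : (mu `]a, b[ < +oo)%E.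
Proof.
by rewrite lebesgue_measure_itv/=; case: ifP => // _; rewrite -EFinD ltry.
Qed.

Lemma continuous_bounded_itv h (a b : R) : a <= b ->
  {within `[a, b], continuous h} ->
  exists M, forall x, x \in `[a, b] -> `|h x| <= M.
Proof.
move=> ab ch; have cnh : {within `[a, b], continuous (fun x => `|h x|)}.
  by move=> x; apply: continuous_comp; [exact: ch|exact: norm_continuous].
by have [c cab H] := EVT_max ab cnh; exists `|h c|.
Qed.

Lemma integrable_mul_bounded D f h (M : R) : measurable D ->
  mu.-integrable D (EFin \o f) -> measurable_fun D h ->
  (forall x, D x -> `|h x| <= M) ->
  mu.-integrable D (EFin \o (fun x => f x * h x)).
Proof.
move=> mD fi mh hM.
have mf : measurable_fun D f by apply/measurable_EFinP; exact: measurable_int fi.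
have iM : mu.-integrable D (fun x => (M%:E * (f x)%:E)%E) by exact: integrableZl.
apply: le_integrable iM => //.
  by apply/measurable_EFinP; exact: measurable_funM.
move=> x Dx /=; rewrite lee_fin !normrM mulrC ler_wpM2r//.
by rewrite (le_trans (hM _ Dx))// ler_norm.
Qed.

Lemma test_function_ends phi : test_function phi -> phi 0 = 0 /\ phi 1 = 0.
Proof.
move=> [_ _ [K [_ K01 phi0]]]; split; apply: phi0 => /K01 /=;
  by rewrite in_itv/= ltxx// andbF.
Qed.

Lemma test_function_continuous phi : test_function phi -> continuous phi.
Proof.
by move=> [dphi _ _] x; apply/differentiable_continuous/derivable1_diffP.
Qed.

(** The boundary term at 1 vanishes because the support is inside ]0, 1[. *)
Lemma test_function_FTC phi (y : R) : test_function phi -> y < 1 ->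
  \int[mu]_(x in `[y, 1]) derive1 phi x = - phi y.
Proof.
move=> tphi y1; have cphi := test_function_continuous tphi.
have [_ p1] := test_function_ends tphi; case: tphi => dphi cdphi _.
have cdphi' : {within `[y, 1], continuous (derive1 phi)}.
  exact: continuous_subspaceT.
have dLR : derivable_oo_LRcontinuous phi y 1.
  split.
  - by move=> x _; exact: dphi.
  - exact/cvg_at_right_filter/cphi.
  - exact/cvg_at_left_filter/cphi.
have := continuous_FTC2 y1 cdphi' dLR (fun x _ => erefl).
by rewrite /Rintegral => ->; rewrite p1 -EFinB/= sub0r.
Qed.

End weak_derivatives.

Section primitives_derivative.
Context {R : realType}.
Notation mu := (@lebesgue_measure R).
Implicit Types (f g h w k phi : R -> R) (D : set R).

Definition primitive w (x : R) : R := \int[mu]_(y in `[0, x]) w y.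

Lemma integrable_itv_oo_cc w (a b : R) : mu.-integrable `]a, b[ (EFin \o w) ->
  mu.-integrable `[a, b] (EFin \o w).
Proof.
move=> iw; have /integrableP[mw wlt] := iw.
apply/integrableP; split.
  apply/measurable_EFinP; apply/measurable_fun_itv_bndo_bndcP.
  by apply/measurable_fun_itv_obnd_cbndP; exact/measurable_EFinP.
rewrite integral_itv_bndoo//; first exact: measurableT_comp.
Qed.

Lemma continuous_primitive w (b : R) : 0 <= b ->
  mu.-integrable `[0, b] (EFin \o w) -> {within `[0, b], continuous (primitive w)}.
Proof. by move=> b0 iw; exact: parameterized_integral_continuous. Qed.

Lemma primitive0 w : primitive w 0 = 0.
Proof. by rewrite /primitive set_itv1 Rintegral_set1. Qed.

Lemma measurable_fun_within f (a b : R) : {within `[a, b], continuous f} ->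
  measurable_fun `]a, b[ f.
Proof.
move=> cf; apply: (measurable_funS (E := `[a, b]%classic)) => //.
  exact: subset_itv_oo_cc.
exact: subspace_continuous_measurable_fun.
Qed.

Lemma Lp_continuous f (p : \bar R) (a b : R) : (1 <= p)%E -> a <= b ->
  {within `[a, b], continuous f} -> Lp p `]a, b[ f.
Proof.
move=> p1 ab cf; have [M fM] := continuous_bounded_itv ab cf.
apply: (bounded_Lp (M := M)) => //.
- exact: lebesgue_measure_itvoo_lty.
- exact: measurable_fun_within.
- by move=> x xab; apply: fM; exact: subset_itv_oo_cc.
Qed.

Lemma locally_integrable_continuous f (a b : R) : a <= b ->
  {within `[a, b], continuous f} -> locally_integrable `]a, b[ f.
Proof.
move=> ab cf; apply: open_integrable_locally; first exact: interval_open.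
apply: (@Lp_integrable _ 1%E) => //; first exact: lebesgue_measure_itvoo_lty.
exact: Lp_continuous.
Qed.

(** Integration by parts without any pointwise differentiation: exchange the two
    integrals, then integrate the derivative of the test function. *)
Lemma weak_derivative_primitive w : mu.-integrable `]0, 1[ (EFin \o w) ->
  weak_derivative (primitive w) w.
Proof.
move=> iw; have iw01 := integrable_itv_oo_cc iw.
have cP := continuous_primitive ler01 iw01.
split; first exact: locally_integrable_continuous cP.
  by apply: open_integrable_locally => //; exact: interval_open.
move=> phi tphi; have cphi := test_function_continuous tphi.
have cdphi : continuous (derive1 phi) by case: tphi.
have idphi : mu.-integrable `[0, 1] (EFin \o derive1 phi).
  apply: continuous_compact_integrable; first exact: segment_compact.
  exact: continuous_subspaceT.
have idphi' : mu.-integrable `]0, 1[ (EFin \o derive1 phi).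
  by apply: integrableS idphi => //; exact: subset_itv_oo_cc.
have res f : mu.-integrable `]0, 1[ (EFin \o f) ->
    mu.-integrable [set: R] (EFin \o (f \_ `]0, 1[)).
  by move=> fi; rewrite -restrict_EFin; apply/integrable_restrict; rewrite ?setTI.
have := Rintegral_triangle (res _ iw) (res _ idphi').
have [M phiM] : exists M : R, forall x : R, x \in `[0, 1] -> `|phi x| <= M.
  apply: continuous_bounded_itv; first exact: ler01.
  exact: continuous_subspaceT.
have iwphi : mu.-integrable `]0, 1[ (EFin \o (fun x => w x * phi x)).
  apply: (integrable_mul_bounded (M := M)) => //.
    by apply: measurable_funTS; exact: continuous_measurable_fun.
  by move=> x x01; apply: phiM; exact: subset_itv_oo_cc.
rewrite -mulN1r -RintegralZl// [in X in _ -> X = _]Rintegral_mkcond.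
rewrite [in X in _ -> _ = X]Rintegral_mkcond => H.
transitivity (\int[mu]_x ((\int[mu]_(y in `]-oo, x]) (w \_ `]0, 1[) y) *
    (derive1 phi \_ `]0, 1[) x)).
  apply: eq_Rintegral => x _; rewrite !patchE.
  case: ifPn => [/set_mem x01|_]; last by rewrite mulr0.
  congr (_ * _).
  move: x01; rewrite /= in_itv/= => /andP[x0 x1].
  rewrite -Rintegral_mkcondr /primitive -Rintegral_itv_obnd_cbnd; last first.
    apply: integrableS iw => //; apply: subset_itvl.
    by rewrite bnd_simp.
  congr (\int[mu]_(y in _) _); apply/seteqP; split => y /=; rewrite !in_itv/=.
    by move=> /andP[y0 yx]; rewrite yx y0 (le_lt_trans yx).
  by move=> [yx /andP[y0 _]]; rewrite y0.
rewrite H; apply: eq_Rintegral => y _; rewrite !patchE.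
case: ifPn => [/set_mem y01|_]; last by rewrite mul0r.
rewrite mulN1r -mulrN; congr (_ * _).
move: y01; rewrite /= in_itv/= => /andP[y0 y1].
rewrite -(test_function_FTC tphi y1) -Rintegral_mkcondr.
rewrite -Rintegral_itv_bndo_bndc; last first.
  apply: integrableS idphi => //; apply: subset_itv; rewrite bnd_simp//.
  exact: ltW.
congr (\int[mu]_(y in _) _); apply/seteqP; split => x /=; rewrite !in_itv/= ?andbT.
  by move=> [yx /andP[_ x1]]; rewrite yx.
by move=> /andP[yx x1]; rewrite yx x1 (lt_le_trans y0).
Qed.

(** The primitive is its own continuous representative and is bounded, hence in
    every L^p. *)
Lemma in_W1p_star_primitive p w : (1 <= p)%E -> Lp p `]0, 1[ w ->
  in_W1p_star p (primitive w) /\ weak_derivative (primitive w) w.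
Proof.
move=> p1 Lw; have iw : mu.-integrable `]0, 1[ (EFin \o w).
  by apply: (Lp_integrable p1) Lw => //; exact: lebesgue_measure_itvoo_lty.
have cP := continuous_primitive ler01 (integrable_itv_oo_cc iw).
have dP := weak_derivative_primitive iw.
split=> //; split.
- exact: Lp_continuous.
- by exists w.
- by exists (primitive w); split => //; [exact: ae_eq_refl|exact: primitive0].
Qed.

End primitives_derivative.

(** * The du Bois-Reymond lemma *)

Section du_bois_reymond.
Context {R : realType}.
Notation mu := (@lebesgue_measure R).
Implicit Types (f g h w k phi v : R -> R) (D : set R) (a b c e x : R).

(** The hat function of height e supported in [c - e, c + e]. *)
Definition tent c e x : R := Num.max 0 (e - `|x - c|).

Lemma tent_ge0 c e x : 0 <= tent c e x.
Proof. by rewrite /tent le_max lexx. Qed.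

Lemma tent_eq0 c e x : e <= `|x - c| -> tent c e x = 0.
Proof. by move=> ecx; apply/max_idPl; rewrite subr_le0. Qed.

Lemma continuous_tent c e : continuous (tent c e).
Proof.
move=> x; apply: (@continuous_max R _ (fun=> 0) (fun y => e - `|y - c|)).
  exact: cst_continuous.
apply: continuousB; first exact: cst_continuous.
apply: continuous_comp; last exact: norm_continuous.
by apply: continuousB; [exact: cvg_id|exact: cst_continuous].
Qed.

Lemma tent_restrict c e D : (forall x, `|x - c| < e -> D x) ->
  tent c e \_ D = tent c e.
Proof.
move=> cD; apply/funext => x; rewrite patchE; case: ifPn => // xD.
rewrite tent_eq0// leNgt; apply/negP => /cD Dx.
by move/negP: xD; apply; exact: mem_set.
Qed.

Lemma integrable_tent c e : mu.-integrable [set: R] (EFin \o tent c e).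
Proof.
have H x : `|x - c| < e -> `[c - e, c + e]%classic x.
  by rewrite /= in_itv/= ltr_distl => /andP[/ltW-> /ltW->].
rewrite -(tent_restrict H) -restrict_EFin.
apply/integrable_restrict; rewrite ?setTI//.
apply: continuous_compact_integrable; first exact: segment_compact.
by apply: continuous_subspaceT; exact: continuous_tent.
Qed.

Lemma Rintegral_tent c e : \int[mu]_x tent c e x = \int[mu]_x tent 0 e x.
Proof.
rewrite /Rintegral; congr fine.
rewrite -(integralT_comp (measure_preserving_shift (- c)) (f := tent 0 e)).
  by apply: eq_integral => x _; rewrite /tent subr0 (addrC (- c)).
by apply: continuous_measurable_fun; exact: continuous_tent.
Qed.

Lemma Rintegral_tent_gt0 c e : 0 < e -> 0 < \int[mu]_x tent c e x.
Proof.
move=> e0; rewrite Rintegral_tent.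
(* on the middle half of its support the tent is at least e / 2 *)
apply: (@lt_le_trans _ _ (\int[mu]_(x in `[- (e / 2), e / 2]) (e / 2))).
  rewrite Rintegral_cst//= lebesgue_measure_itv/= lte_fin gtrN ?divr_gt0//.
  by rewrite -EFinD/= opprK mulr_gt0// ?addr_gt0 ?divr_gt0.
rewrite [leRHS]Rintegral_mkcond.
apply: (@le_trans _ _ (\int[mu]_(x in `[- (e / 2), e / 2]) tent 0 e x)).
  apply: le_Rintegral => //.
  - apply: continuous_compact_integrable; first exact: segment_compact.
    by apply: continuous_subspaceT => x; exact: cst_continuous.
  - by apply: integrableS (integrable_tent 0 e).
  move=> x; rewrite /= in_itv/= -ler_norml => xe.
  by rewrite /tent subr0 le_max; apply/orP; right; lra.
rewrite Rintegral_mkcond.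
apply: le_Rintegral => //.
- rewrite -restrict_EFin; apply/integrable_restrict => //.
  by rewrite setTI; apply: integrableS (integrable_tent 0 e).
- by rewrite -restrict_EFin; apply/integrable_restrict => //;
    rewrite setTI; exact: integrable_tent.
- move=> x _; rewrite patchE [leRHS]patchE in_setT.
  by case: ifPn => // _; exact: tent_ge0.
Qed.

(** The test function of the du Bois-Reymond lemma: its derivative is a tent
    at a minus a tent at b.  As the two tents have the same integral, it vanishes
    beyond both supports. *)
Definition tent_gap a b e x : R :=
  \int[mu]_(y in `]-oo, x]) (tent a e y - tent b e y).

Lemma continuous_tentB a b e : continuous (fun x => tent a e x - tent b e x).
Proof. by move=> x; apply: continuousB; exact: continuous_tent. Qed.

Lemma integrable_tentB a b e :
  mu.-integrable [set: R] (EFin \o (fun x => tent a e x - tent b e x)).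
Proof.
suff : mu.-integrable [set: R] ((EFin \o tent a e) \- (EFin \o tent b e))%E by [].
by apply: integrableB => //; exact: integrable_tent.
Qed.

Lemma derive_tent_gap a b e x : derivable (tent_gap a b e) x 1 /\
  derive1 (tent_gap a b e) x = tent a e x - tent b e x.
Proof.
apply: (@continuous_FTC1 R (fun x => tent a e x - tent b e x) -oo%O x (x + 1)).
- by rewrite ltrDl.
- by apply: integrableS (integrable_tentB a b e).
- exact: ltNyr.
- exact: continuous_tentB.
Qed.

Lemma test_function_tent_gap a b e : 0 < e ->
  0 < a - e -> a + e < 1 -> 0 < b - e -> b + e < 1 ->
  test_function (tent_gap a b e).
Proof.
move=> e0 a0 a1 b0 b1; have D x := derive_tent_gap a b e x; split.
- by move=> x; have [] := D x.
- have -> : derive1 (tent_gap a b e) = fun x => tent a e x - tent b e x.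
    by apply/funext => x; have [] := D x.
  exact: continuous_tentB.
exists `[Num.min a b - e, Num.max a b + e]%classic; split.
- exact: segment_compact.
- apply: subset_itv; rewrite bnd_simp.
    by case: (leP a b).
  by case: (leP a b).
move=> x /negP; rewrite /= in_itv/= negb_and -!ltNge => /orP[xm|xM].
  rewrite /tent_gap (@eq_Rintegral _ _ _ mu _ (fun=> 0)).
    by rewrite Rintegral_cst// mul0r.
  move=> y; rewrite inE/= in_itv/= => yx.
  have ym := le_lt_trans yx xm.
  have [ya yb] : y < a - e /\ y < b - e.
    by move: ym; case: (leP a b) => ab ym; split => //; lra.
  rewrite !tent_eq0 ?subrr//; rewrite distrC (le_trans _ (ler_norm _))//; lra.
rewrite /tent_gap Rintegral_mkcond.
rewrite (@eq_Rintegral _ _ _ mu _ (fun x => tent a e x - tent b e x)).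
  rewrite RintegralB//; try exact: integrable_tent.
  by rewrite !Rintegral_tent subrr.
move=> y _; rewrite patchE; case: ifPn => //.
rewrite mem_setE in_itv/= -ltNge => xy.
have yM := lt_trans xM xy.
have [ya yb] : a + e < y /\ b + e < y.
  by move: yM; case: (leP a b) => ab yM; split => //; lra.
rewrite !tent_eq0 ?subrr//; rewrite (le_trans _ (ler_norm _))//; lra.
Qed.

End du_bois_reymond.

Section du_bois_reymond_lemma.
Context {R : realType}.
Notation mu := (@lebesgue_measure R).
Implicit Types (v phi : R -> R).

(** If v a < v b, separate them by m1 < m2 and take e so small that v < m1 on
    the support of the tent at a and m2 < v on that of the tent at b.  Tested against the tents, v has a
    smaller integral at a than at b, while [tent_gap] makes these two integrals
    equal. *)
Lemma du_bois_reymond_le v (a b : R) : {within `[0, 1], continuous v} ->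
  (forall phi, test_function phi ->
     \int[mu]_(x in `]0, 1[) (v x * derive1 phi x) = 0) ->
  0 < a < 1 -> 0 < b < 1 -> v b <= v a.
Proof.
move=> cv v0 /andP[a0 a1] /andP[b0 b1]; rewrite leNgt; apply/negP => vab.
have [cvin _ _] := (continuous_within_itvP _ ltr01).1 cv.
pose m1 := v a + (v b - v a) / 3; pose m2 := v a + (v b - v a) * 2 / 3.
have va1 : v a < m1 by rewrite /m1; lra.
have m12 : m1 < m2 by rewrite /m1 /m2; lra.
have m2b : m2 < v b by rewrite /m2; lra.
have [ea /= ea0 Ea] : exists2 e : R, 0 < e &
    forall x, `|x - a| < e -> v x < m1 /\ 0 < x < 1.
  have ina : a \in `]0, 1[ by rewrite in_itv/= a0.
  have : \forall x \near a, v x < m1 /\ 0 < x < 1.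
    near=> x; split; first by near: x; exact: (cvgr_lt _ (cvin _ ina)).
    by apply/andP; split; near: x; [exact: lt_nbhsr|exact: lt_nbhsl].
  move=> /nbhs_ballP[e /= e0 eH]; exists e => // x xa; apply: eH.
  by rewrite /ball/= distrC.
have [eb /= eb0 Eb] : exists2 e : R, 0 < e &
    forall x, `|x - b| < e -> m2 < v x /\ 0 < x < 1.
  have inb : b \in `]0, 1[ by rewrite in_itv/= b0.
  have : \forall x \near b, m2 < v x /\ 0 < x < 1.
    near=> x; split; first by near: x; exact: (cvgr_gt _ (cvin _ inb)).
    by apply/andP; split; near: x; [exact: lt_nbhsr|exact: lt_nbhsl].
  move=> /nbhs_ballP[e /= e0 eH]; exists e => // x xa; apply: eH.
  by rewrite /ball/= distrC.
pose e := Num.min ea eb / 2.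
have e0 : 0 < e by rewrite /e divr_gt0// lt_min ea0.
have [eea eeb] : e < ea /\ e < eb.
  by rewrite /e; case: (leP ea eb) => ?; split; lra.
have ta x : `|x - a| <= e -> v x < m1 /\ 0 < x < 1.
  by move=> xa; apply: Ea; exact: le_lt_trans xa eea.
have tb x : `|x - b| <= e -> m2 < v x /\ 0 < x < 1.
  by move=> xb; apply: Eb; exact: le_lt_trans xb eeb.
(* the end points of the closed tents stay inside ]0, 1[ *)
have D (x : R) : [/\ `|x - e - x| <= e & `|x + e - x| <= e].
  split; first by rewrite addrAC subrr sub0r normrN gtr0_norm.
  by rewrite addrAC subrr add0r gtr0_norm.
have [D1 D2] := D a; have [D3 D4] := D b.
have [_ /andP[ae0 _]] := ta _ D1; have [_ /andP[_ ae1]] := ta _ D2.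
have [_ /andP[be0 _]] := tb _ D3; have [_ /andP[_ be1]] := tb _ D4.
have := v0 _ (test_function_tent_gap e0 ae0 ae1 be0 be1).
under eq_Rintegral do rewrite (derive_tent_gap a b e _).2.
apply/eqP; rewrite lt_eqF//.
have itent c : mu.-integrable `]0, 1[ (EFin \o tent c e).
  by apply: integrableS (integrable_tent c e).
have itentZ m c : mu.-integrable `]0, 1[ (EFin \o (fun x => m * tent c e x)).
  suff : mu.-integrable `]0, 1[ (fun x => m%:E * (tent c e x)%:E)%E by [].
  by apply: integrableZl => //; exact: itent.
have I c : (forall x, `|x - c| <= e -> 0 < x < 1) ->
    \int[mu]_(x in `]0, 1[) tent c e x = \int[mu]_x tent 0 e x.
  move=> cH; rewrite Rintegral_mkcond tent_restrict ?Rintegral_tent//.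
  by move=> x xc; rewrite /= in_itv/=; apply: cH; exact: ltW.
apply: (@le_lt_trans _ _
    (\int[mu]_(x in `]0, 1[) (m1 * tent a e x - m2 * tent b e x))); last first.
  rewrite RintegralB//.
  rewrite !RintegralZl// !I; first last.
  - by move=> x /ta[].
  - by move=> x /tb[].
  rewrite -mulrBl nmulr_rlt0 ?subr_lt0//.
  exact: Rintegral_tent_gt0.
have [M vM] := continuous_bounded_itv ler01 cv.
apply: le_Rintegral => //.
- rewrite (_ : (fun x => v x * _) =
      (fun x => (tent a e x - tent b e x) * v x)); last first.
    by apply/funext => x; rewrite mulrC.
  apply: (integrable_mul_bounded (M := M)) => //.
  + by apply: integrableS (integrable_tentB a b e).
  + exact: measurable_fun_within.
  + by move=> x x01; apply: vM; exact: subset_itv_oo_cc.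
- suff : mu.-integrable `]0, 1[ ((EFin \o (fun x => m1 * tent a e x)%R) \-
      (EFin \o (fun x => m2 * tent b e x)%R))%E by [].
  by apply: integrableB => //; exact: itentZ.
move=> x _; rewrite mulrBr; apply: lerB.
- have [xa|xa] := leP `|x - a| e; last by rewrite tent_eq0 ?mulr0// ltW.
  by apply: ler_wpM2r; [exact: tent_ge0|apply/ltW; exact: (ta _ xa).1].
- have [xb|xb] := leP `|x - b| e; last by rewrite tent_eq0 ?mulr0// ltW.
  by apply: ler_wpM2r; [exact: tent_ge0|apply/ltW; exact: (tb _ xb).1].
Unshelve. all: by end_near. Qed.

(** The value on ]0, 1[ is constant by [du_bois_reymond_le] in both directions;
    continuity at 0 identifies the constant. *)
Lemma du_bois_reymond v (x : R) : {within `[0, 1], continuous v} ->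
  (forall phi, test_function phi ->
     \int[mu]_(y in `]0, 1[) (v y * derive1 phi y) = 0) ->
  0 < x < 1 -> v x = v 0.
Proof.
move=> cv v0 x01.
have [_ cv0 _] := (continuous_within_itvP _ ltr01).1 cv.
have vx : v y @[y --> 0^'+] --> v x.
  have : (fun=> v x) y @[y --> (0 : R)^'+] --> v x by exact: cvg_cst.
  apply: cvg_trans; apply: near_eq_cvg; near=> y.
  have y01 : 0 < y < 1 by apply/andP; split; near: y;
    [exact: nbhs_right_gt|exact: nbhs_right_lt].
  by apply/eqP; rewrite eq_le !du_bois_reymond_le.
exact: (cvg_unique _ vx cv0).
Unshelve. all: by end_near. Qed.

End du_bois_reymond_lemma.

Section weak_derivative_uniqueness.
Context {R : realType}.
Notation mu := (@lebesgue_measure R).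
Implicit Types (f g h u v w du phi : R -> R).

Lemma integrable_test_derive u phi : {within `[0, 1], continuous u} ->
  test_function phi ->
  mu.-integrable `]0, 1[ (EFin \o (fun x => u x * derive1 phi x)).
Proof.
move=> cu [_ cdphi _]; have [M uM] := continuous_bounded_itv ler01 cu.
rewrite (_ : (fun x => _) = (fun x => derive1 phi x * u x)); last first.
  by apply/funext => x; rewrite mulrC.
apply: (integrable_mul_bounded (M := M)) => //.
- have : mu.-integrable `[0, 1] (EFin \o derive1 phi).
    apply: continuous_compact_integrable; first exact: segment_compact.
    exact: continuous_subspaceT.
  by apply: integrableS => //; exact: subset_itv_oo_cc.
- exact: measurable_fun_within.
- by move=> x x01; apply: uM; exact: subset_itv_oo_cc.
Qed.

Lemma ae_eq_Rintegral_mul f g phi : measurable_fun `]0 : R, 1[ f ->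
  measurable_fun `]0 : R, 1[ g -> continuous phi ->
  f = g %[ae mu in `]0, 1[%classic] ->
  \int[mu]_(x in `]0, 1[) (f x * phi x) = \int[mu]_(x in `]0, 1[) (g x * phi x).
Proof.
move=> mf mg cphi fg; rewrite /Rintegral; congr fine.
have mphi : measurable_fun `]0 : R, 1[ phi.
  by apply: measurable_funTS; exact: continuous_measurable_fun.
apply: ae_eq_integral => //.
- by apply/measurable_EFinP; exact: measurable_funM.
- by apply/measurable_EFinP; exact: measurable_funM.
- by apply: (ae_imp fg) => x fgx x01; rewrite fgx.
Qed.

Lemma eq_ae_weak_derivative u v du : locally_integrable `]0, 1[ v ->
  u = v %[ae mu in `]0, 1[%classic] -> weak_derivative u du ->
  weak_derivative v du.
Proof.
move=> lv uv [lu ldu H]; split => // phi tphi; rewrite -H//.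
have [_ cdphi _] := tphi; have [mu_ _ _] := lu; have [mv _ _] := lv.
by apply: ae_eq_Rintegral_mul => //; exact: ae_eq_sym.
Qed.

(** The continuous representative of u and the primitive of w have the same weak
    derivative and both vanish at 0. *)
Lemma weak_derivative_vanishes_unique u du w : weak_derivative u du ->
  vanishes_at_0 u -> mu.-integrable `]0, 1[ (EFin \o w) ->
  du = w %[ae mu in `]0, 1[%classic] ->
  u = primitive w %[ae mu in `]0, 1[%classic].
Proof.
move=> dudu [v [cv vu v0]] iw duw.
have cP := continuous_primitive ler01 (integrable_itv_oo_cc iw).
have [_ [mw _ _] dP] := weak_derivative_primitive iw.
have lv := locally_integrable_continuous ler01 cv.
have [_ [mdu _ _] dv] := eq_ae_weak_derivative lv (ae_eq_sym vu) dudu.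
have vP x : 0 < x < 1 -> v x = primitive w x.
  move=> x01; apply/eqP; rewrite -subr_eq0.
  rewrite (@du_bois_reymond _ (fun x => v x - primitive w x))//.
  - by rewrite v0 primitive0 subrr.
  - by move=> y; apply: continuousB; [exact: cv|exact: cP].
  move=> phi tphi; have cphi := test_function_continuous tphi.
  rewrite (_ : (fun y => _) = (fun y => v y * derive1 phi y -
      primitive w y * derive1 phi y)); last first.
    by apply/funext => y; rewrite mulrBl.
  rewrite RintegralB//; try exact: integrable_test_derive.
  by rewrite dv// dP// (ae_eq_Rintegral_mul mdu mw cphi duw) subrr.
apply: (ae_imp vu) => x vux x01; rewrite -vux//.
by apply: vP; move: x01; rewrite /= in_itv.
Qed.

End weak_derivative_uniqueness.

(** * Uniqueness of the travelling waves *)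

Section uniqueness_of_profiles.
Context {R : realType}.
Notation mu := (@lebesgue_measure R).
Implicit Types (f g : R -> R) (a x y : R).

(** Lebesgue differentiation: the primitive of f is identically 0 and has
    derivative f almost everywhere.  The theorem is applied to truncations of f
    to [a, a + n], because f is only integrable on bounded intervals. *)
Lemma ae_eq0_primitive f a :
  (forall y, mu.-integrable `[a, y] (EFin \o f)) ->
  (forall y, a <= y -> \int[mu]_(x in `[a, y]) f x = 0) ->
  {ae mu, forall x, a < x -> f x = 0}.
Proof.
move=> fi f0.
have H n : {ae mu, forall x, a < x -> x < a + n%:R -> f x = 0}.
  pose k := f \_ `[a, a + n%:R].
  have ki : mu.-integrable [set: R] (EFin \o k).
    by rewrite -restrict_EFin; apply/integrable_restrict; rewrite ?setTI.
  have kl : locally_integrable [set: R] k by exact: integrable_locally.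
  have kiy y : mu.-integrable `[a, y] (EFin \o k) by apply: integrableS ki.
  have F0 y : \int[mu]_(x in `[a, y]) k x = 0.
    rewrite -Rintegral_mkcondr -(@f0 (Num.max a (Num.min y (a + n%:R)))); last first.
      by rewrite le_max lexx.
    have [ya|ay] := ltP y a.
      rewrite set_itv_ge ?bnd_simp -?ltNge// set0I Rintegral_set0.
      rewrite max_l ?set_itv1 ?Rintegral_set1//.
      by rewrite ge_min ltW.
    rewrite max_r; last by rewrite le_min ay lerDl ler0n.
    congr (\int[mu]_(x in _) _); apply/seteqP; split => x /=; rewrite !in_itv/= le_min.
      by move=> [/andP[-> ->] /andP[_ ->]].
    by move=> /and3P[-> -> ->].
  have := FTC1 (a := BLeft a) kiy kl => /ae_imp; apply => x + ax xn.
  have ax' : (BLeft a < BRight x)%E by rewrite lte_fin.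
  move=> /(_ ax')[_].
  have -> : (fun y => \int[mu]_(x in `[a, y]) k x) = cst 0.
    by apply/funext => y; rewrite F0.
  rewrite derive1_cst /k patchE mem_set//=.
  by rewrite in_itv/= !ltW.
have /ae_imp := (@ae_foralln _ _ _ mu _ H).
apply => x Hx ax; apply: (Hx (Num.truncn (x - a)).+1 ax).
by rewrite -ltrBlDl truncnS_gt.
Qed.

(** In the variables u = t + x and v = t - x the hypothesis is
    A u + B v = 0 on the strip 0 <= u - v <= 2 above the line u + v = 0.  The
    choice v = 0 gives A = 0 on [0, 2]; the choices v = u - 2 with first entries
    u and u - 2 show that A has period 2; B v is then read off at u = |v|. *)
Lemma opposite_waves_eq0 (A B : R -> R) : A 0 = 0 -> B 0 = 0 ->
  (forall t x, 0 <= t -> 0 <= x <= 1 -> A (t + x) + B (t - x) = 0) ->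
  (forall u, 0 <= u -> A u = 0) /\ (forall v, -1 <= v -> B v = 0).
Proof.
move=> A0 B0 AB.
have AB' u v : 0 <= u + v -> 0 <= u - v <= 2 -> A u + B v = 0.
  move=> uv /andP[uv0 uv2]; have := @AB ((u + v) / 2) ((u - v) / 2).
  have -> : (u + v) / 2 + (u - v) / 2 = u by field.
  have -> : (u + v) / 2 - (u - v) / 2 = v by field.
  by apply; lra.
have An n u : 0 <= u -> u < n%:R -> A u = 0.
  elim: n u => [u u0 /(le_lt_trans u0)|n IH u u0 un]; first by rewrite ltxx.
  have [u2|u2] := leP u 2.
    by have := @AB' u 0; rewrite B0 !addr0 => -> //; lra.
  have [e1 e2] : A u + B (u - 2) = 0 /\ A (u - 2) + B (u - 2) = 0.
    by split; apply: AB'; lra.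
  have : A (u - 2) = 0 by apply: IH; [lra|rewrite -natr1 in un; lra].
  by move=> e3; move: e1 e2; rewrite e3 add0r => + e4; rewrite e4 addr0.
have Az u : 0 <= u -> A u = 0.
  by move=> u0; apply: (@An (Num.truncn u).+1) => //; exact: truncnS_gt.
split=> // v v1; have [v0|v0] := leP 0 v.
  by have := @AB' v v; rewrite Az// add0r => -> //; lra.
by have := @AB' (- v) v; rewrite Az ?add0r => [->|]; lra.
Qed.

End uniqueness_of_profiles.

Section dalembert_profiles.
Context {R : realType}.
Notation mu := (@lebesgue_measure R).
Implicit Types (f g : R -> R) (z : R -> R -> R) (a x y u v : R) (p : \bar R).

Lemma Lp_loc_integrable p a f y : (1 <= p)%E -> Lp_loc p a f ->
  mu.-integrable `[a, y] (EFin \o f).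
Proof.
move=> p1 [mf Lf]; have aT : a < Num.max y (a + 1) by rewrite lt_max ltrDl ltr01 orbT.
suff : mu.-integrable `[a, Num.max y (a + 1)] (EFin \o f).
  by apply: integrableS => //; apply: subset_itvl; rewrite bnd_simp le_max lexx.
apply: integrable_itv_oo_cc; apply: (@Lp_integrable _ p) => //; last exact: Lf.
exact: lebesgue_measure_itvoo_lty.
Qed.

Lemma Rintegral_comp (T : R -> R) (D : set R) f : measure_preserving T ->
  measurable D -> measurable_fun D f ->
  \int[mu]_(x in T @^-1` D) f (T x) = \int[mu]_(x in D) f x.
Proof.
move=> Tmp mD mf; rewrite Rintegral_mkcond [RHS]Rintegral_mkcond.
rewrite -[(fun x => f (T x)) \_ _]/((f \o T) \_ (T @^-1` D)) restrict_comp.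
rewrite /Rintegral; congr fine.
by apply: (integralT_comp (f := f \_ D)) => //; apply/(measurable_restrictT _ mD).
Qed.

Lemma integrable_comp (T : R -> R) (D : set R) f : measure_preserving T ->
  measurable D -> mu.-integrable D (EFin \o f) ->
  mu.-integrable (T @^-1` D) (EFin \o (f \o T)).
Proof.
move=> Tmp mD fi; have mTD := measurable_preimage Tmp mD.
have mf : measurable_fun D f by apply/measurable_EFinP; exact: measurable_int fi.
have /integrableP[_ flt] := fi; apply/integrableP; split.
  by apply/measurable_EFinP; exact: measurable_fun_comp_preserving.
rewrite (ge0_integral_comp (F := fun x => `|(f x)%:E|%E) Tmp)//.
by apply/measurable_EFinP; exact: measurableT_comp.
Qed.

Lemma oint_ge0 f u : 0 <= u -> oint 0 u f = \int[mu]_(x in `[0, u]) f x.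
Proof. by rewrite /oint => ->. Qed.

Lemma oint0 f : oint 0 0 f = 0.
Proof. by rewrite oint_ge0// set_itv1 Rintegral_set1. Qed.

Lemma oint_lt0 f v : v < 0 -> oint 0 v f = - \int[mu]_(x in `[v, 0]) f x.
Proof. by rewrite /oint leNgt => ->. Qed.

Lemma ointB f g a v : a <= 0 -> a <= v ->
  (forall y, mu.-integrable `[a, y] (EFin \o f)) ->
  (forall y, mu.-integrable `[a, y] (EFin \o g)) ->
  oint 0 v (fun x => f x - g x) = oint 0 v f - oint 0 v g.
Proof.
move=> a0 av fi gi; have sub y b : a <= b -> `[b, y]%classic `<=` `[a, y]%classic.
  by move=> ab; apply: subset_itvr; rewrite bnd_simp.
have [v0|v0] := leP 0 v.
  rewrite !oint_ge0// RintegralB//.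
    by apply: integrableS (fi v) => //; exact: sub.
  by apply: integrableS (gi v) => //; exact: sub.
rewrite !oint_lt0// RintegralB//; first by rewrite opprD.
  by apply: integrableS (fi 0) => //; exact: sub.
by apply: integrableS (gi 0) => //; exact: sub.
Qed.

(** Here the primitive is based at 0 while the domain ]a, +oo[ may start to the
    left of 0, as it does for g with a = -1. *)
Lemma ae_eq0_oint f a : a <= 0 ->
  (forall y, mu.-integrable `[a, y] (EFin \o f)) ->
  (forall v, a <= v -> oint 0 v f = 0) ->
  {ae mu, forall x, a < x -> f x = 0}.
Proof.
move=> a0 fi f0; apply: ae_eq0_primitive => // y ay.
have sub (b c : R) : a <= b -> mu.-integrable `[b, c] (EFin \o f).
  move=> ab; apply: integrableS (fi c) => //; apply: subset_itvr.
  by rewrite bnd_simp.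
have cut (b c : R) : a <= b -> b <= c -> \int[mu]_(x in `[a, c]) f x =
    \int[mu]_(x in `[a, b]) f x + \int[mu]_(x in `[b, c]) f x.
  move=> ab bc; rewrite -[X in _ = _ + X]Rintegral_itv_obnd_cbnd; last first.
    by apply: integrableS (sub b c ab) => //; exact: subset_itv_oc_cc.
  by rewrite -(Rintegral_itvB (fi c))// ?bnd_simp// addrC subrK.
have fa0 : \int[mu]_(x in `[a, 0]) f x = 0.
  have := f0 _ (lexx a); move: a0; rewrite le_eqVlt => /predU1P[->|a0].
    by rewrite set_itv1 Rintegral_set1.
  by rewrite oint_lt0// => /eqP; rewrite oppr_eq0 => /eqP.
have [y0|y0] := leP 0 y.
  by rewrite (cut 0)// fa0 add0r -oint_ge0// f0.
move: fa0; rewrite (cut y 0)// ?ltW//.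
have /eqP := f0 _ ay; rewrite oint_lt0// oppr_eq0 => /eqP ->.
by rewrite addr0.
Qed.

(** [opposite_waves_eq0] applies to the differences of the two pairs of
    primitives. *)
Lemma profiles_unique p f g f' g' z : (1 <= p)%E ->
  Lp_loc p 0 f -> Lp_loc p (-1) g -> dalembert f g z ->
  Lp_loc p 0 f' -> Lp_loc p (-1) g' -> dalembert f' g' z ->
  {ae mu, forall x, 0 < x -> f x = f' x} /\
  {ae mu, forall x, -1 < x -> g x = g' x}.
Proof.
move=> p1 Lf Lg fgz Lf' Lg' fgz'.
have fi y := Lp_loc_integrable y p1 Lf; have gi y := Lp_loc_integrable y p1 Lg.
have fi' y := Lp_loc_integrable y p1 Lf'; have gi' y := Lp_loc_integrable y p1 Lg'.
have [|||A0 B0] := @opposite_waves_eq0 R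
  (fun u => oint 0 u f - oint 0 u f') (fun v => oint 0 v g - oint 0 v g').
- by rewrite !oint0 subrr.
- by rewrite !oint0 subrr.
- move=> t x t0 x01; have := fgz _ _ t0 x01; rewrite fgz'// -!mulrDr.
  move/(mulfI _); rewrite invr_eq0 sqrtr_eq0 -ltNge ltr0n => /(_ isT).
  by move=> /eqP; rewrite eq_sym -subr_eq0 => /eqP E; rewrite -[RHS]E; ring.
have N10 : (-1 : R) <= 0 by rewrite oppr_le0.
have di h h' a : (forall y, mu.-integrable `[a, y] (EFin \o h)) ->
    (forall y, mu.-integrable `[a, y] (EFin \o h')) ->
    forall y, mu.-integrable `[a, y] (EFin \o (fun x => h x - h' x)).
  move=> hi hi' y.
  suff : mu.-integrable `[a, y] ((EFin \o h) \- (EFin \o h'))%E by [].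
  exact: integrableB.
split.
- have := @ae_eq0_oint (fun x => f x - f' x) 0 (lexx 0) (di _ _ _ fi fi').
  move=> /(_ _)/ae_imp; apply; last first.
    by move=> x + x0 => /(_ x0)/eqP; rewrite subr_eq0 => /eqP.
  by move=> v v0; rewrite (@ointB _ _ 0)// A0.
- have := @ae_eq0_oint (fun x => g x - g' x) (-1) N10 (di _ _ _ gi gi').
  move=> /(_ _)/ae_imp; apply; last first.
    by move=> x + x0 => /(_ x0)/eqP; rewrite subr_eq0 => /eqP.
  by move=> v v0; rewrite (@ointB _ _ (-1))// B0.
Qed.

(** The reflection y |-> -y turns the integral of g over [-x, 0] into one over
    [0, x], so that the two integrals of the d'Alembert formula combine. *)
Lemma dalembert0 f g z x :
  (forall y, mu.-integrable `[0, y] (EFin \o f)) ->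
  (forall y, mu.-integrable `[-1, y] (EFin \o g)) ->
  dalembert f g z -> 0 <= x <= 1 -> z 0 x = primitive (wave_x f g 0) x.
Proof.
move=> fi gi fgz x01; rewrite fgz// add0r sub0r; have /andP[x0 x1] := x01.
have gix : mu.-integrable `[- x, 0] (EFin \o g).
  by apply: integrableS (gi 0) => //; apply: subset_itvr; rewrite bnd_simp lerN2.
have mg : measurable_fun `[- x, 0] g.
  by apply/measurable_EFinP; exact: measurable_int gix.
have T01 : (fun y : R => 0 - y) @^-1` `[- x, 0] = `[0, x]%classic.
  by apply/seteqP; split => y /=; rewrite !in_itv/= sub0r lerN2 oppr_le0 andbC.
have gix' : mu.-integrable `[0, x] (EFin \o (fun y => g (0 - y))).
  rewrite -T01; apply: (integrable_comp (measure_preserving_reflect 0)) => //.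
have -> : oint 0 (- x) g = - \int[mu]_(y in `[0, x]) g (0 - y).
  rewrite -T01 (Rintegral_comp (measure_preserving_reflect 0))//.
  move: x0; rewrite le_eqVlt => /predU1P[<-|x0].
    by rewrite oppr0 oint0 set_itv1 Rintegral_set1 oppr0.
  by rewrite oint_lt0// oppr_lt0.
rewrite oint_ge0// mulrN -mulrBr -RintegralB//.
rewrite mulrC -RintegralZr//.
  by apply: eq_Rintegral => y _; rewrite /wave_x !add0r.
suff : mu.-integrable `[0, x] ((EFin \o f) \- (EFin \o (fun y => g (0 - y)%R)))%E by [].
exact: integrableB.
Qed.

End dalembert_profiles.

(** * The energy in terms of the travelling waves *)

Section energy_identity.
Context {R : realType}.
Notation mu := (@lebesgue_measure R).
Implicit Types (f g h : R -> R) (D : set R) (p : \bar R).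
Local Open Scope ereal_scope.

Lemma Lp_normZ p D f (a : R) : 1 <= p -> Lp p D f ->
  Lp_norm p D (fun x => a * f x)%R = `|a|%:E * Lp_norm p D f.
Proof.
move=> p1 Lf; rewrite /Lp_norm -(LnormZ (Lfun_Sub p1 Lf) a).
apply: eq_Lnorm => x /=; congr EFin; rewrite patchE [in RHS]patchE.
by case: ifPn => // _; rewrite scaler0.
Qed.

Lemma Lp_norm_poweR r D f : (0 < r)%R -> measurable D ->
  Lp_norm r%:E D f `^ r = \int[mu]_(x in D) (`|f x| `^ r)%:E.
Proof.
move=> r0 mD; have rN0 : (r != 0)%R by rewrite gt_eqF.
rewrite /Lp_norm (poweR_Lnorm _ _ rN0) [RHS]integral_mkcond.
apply: eq_integral => x _; rewrite /= !patchE; case: ifPn => // _.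
by rewrite normr0 powR0// gt_eqF.
Qed.

(** Since du + v = sqrt 2 F and du - v = - sqrt 2 G, the normalising factors in
    the norm of X_p cancel the powers of sqrt 2. *)
Lemma Xp_norm_characteristics p F G : 1 <= p ->
  Lp p `]0%R, 1%R[ F -> Lp p `]0%R, 1%R[ G ->
  let du x := ((F x - G x) / Num.sqrt 2)%R in
  let v x := ((F x + G x) / Num.sqrt 2)%R in
  match p with
  | r%:E => Xp_norm p du v `^ r = Lp_norm p `]0%R, 1%R[ F `^ r +
                                 Lp_norm p `]0%R, 1%R[ G `^ r
  | +oo => Xp_norm p du v = maxe (Lp_norm p `]0%R, 1%R[ F)
                                 (Lp_norm p `]0%R, 1%R[ G)
  | -oo => True
  end.
Proof.
move=> p1 LF LG du v.
have s2 : (0 < Num.sqrt 2 :> R)%R by rewrite sqrtr_gt0.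
have s22 : (Num.sqrt 2 * Num.sqrt 2 = 2 :> R)%R by rewrite -expr2 sqr_sqrtr.
have s2V : ((Num.sqrt 2)^-1 = Num.sqrt 2 / 2 :> R)%R.
  by rewrite -[X in (_ / X)%R]s22 invfM mulrA divff ?gt_eqF// mul1r.
have duv x : (du x + v x = Num.sqrt 2 * F x)%R by rewrite /du /v s2V; field.
have dumv x : (du x - v x = - Num.sqrt 2 * G x)%R by rewrite /du /v s2V; field.
case: p p1 LF LG => [r r1 LF LG|_ LF LG|//].
- have r0 : (0 < r)%R by rewrite (lt_le_trans ltr01)// -lee_fin.
  rewrite /Xp_norm -poweRrM mulVf ?gt_eqF// poweRe1; last first.
    rewrite mule_ge0 ?lee_fin ?powR_ge0//; apply: integral_ge0 => x _.
    by rewrite lee_fin addr_ge0 ?powR_ge0.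
  have mF := Lp_measurable_fun (measurable_itv `]0%R, 1%R[) LF.
  have mG := Lp_measurable_fun (measurable_itv `]0%R, 1%R[) LG.
  have mpow h : measurable_fun (`]0, 1[%classic%R : set R) h ->
      measurable_fun (`]0, 1[%classic%R : set R) (fun x => (`|h x| `^ r)%:E).
    move=> mh; apply/measurable_EFinP.
    apply: (measurableT_comp (measurable_powR _)) => //.
    exact: measurableT_comp.
  rewrite !Lp_norm_poweR// -ge0_integralD//=; [|exact: mpow|exact: mpow].
  have key x : (`|du x + v x| `^ r + `|du x - v x| `^ r =
      2 `^ (r / 2) * (`|F x| `^ r + `|G x| `^ r))%R.
    rewrite duv dumv !normrM normrN (gtr0_norm s2) !powRM//.
    by rewrite -mulrDr -powR12_sqrt// -powRrM (mulrC 2^-1%R).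
  under eq_integral do rewrite key.
  rewrite -ge0_integralZl_EFin ?powR_ge0//.
  + apply: eq_integral => x _.
    rewrite -EFinM mulrA -powRD ?pnatr_eq0 ?implybT//.
    by rewrite addNr powRr0 mul1r EFinD.
  + apply/measurable_EFinP/measurable_funM => //.
    by apply: measurable_funD; apply/measurable_EFinP; exact: mpow.
- rewrite /Xp_norm (_ : du \+ v = fun x => Num.sqrt 2 * F x)%R; last exact/funext.
  rewrite (_ : du \- v = fun x => - Num.sqrt 2 * G x)%R; last exact/funext.
  rewrite (Lp_normZ (Num.sqrt 2) (leey _) LF).
  rewrite (Lp_normZ (- Num.sqrt 2)%R (leey _) LG) normrN gtr0_norm//.
  rewrite -maxe_pMr ?lee_fin ?(ltW s2)//.
  by rewrite muleA -EFinM mulVf ?gt_eqF// mul1e.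
Qed.

End energy_identity.

Section energy_of_solutions.
Context {R : realType}.
Notation mu := (@lebesgue_measure R).
Implicit Types (f g h : R -> R) (z : R -> R -> R) (a b c t : R) (p : \bar R).

Lemma shift_itvoo a b c :
  (fun x : R => c + x) @^-1` `]c + a, c + b[ = `]a, b[%classic.
Proof. by apply/seteqP; split => x /=; rewrite !in_itv/= !ltrD2l. Qed.

Lemma reflect_itvoo a b c :
  (fun x : R => c - x) @^-1` `]c - b, c - a[ = `]a, b[%classic.
Proof. by apply/seteqP; split => x /=; rewrite !in_itv/= !ltrD2l !ltrN2 andbC. Qed.

Lemma Lp_shift p a b c f : (1 <= p)%E ->
  Lp p `]c + a, c + b[ f -> Lp p `]a, b[ (fun x => f (c + x)).
Proof.
move=> p1 Lf; rewrite -(shift_itvoo a b c).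
exact: (Lp_comp p1 (measure_preserving_shift c) Lf).
Qed.

Lemma Lp_reflect p a b c f : (1 <= p)%E ->
  Lp p `]c - b, c - a[ f -> Lp p `]a, b[ (fun x => f (c - x)).
Proof.
move=> p1 Lf; rewrite -(reflect_itvoo a b c).
exact: (Lp_comp p1 (measure_preserving_reflect c) Lf).
Qed.

Lemma Lp_norm_shift p a b c f : (1 <= p)%E -> Lp p `]c + a, c + b[ f ->
  Lp_norm p `]a, b[ (fun x => f (c + x)) = Lp_norm p `]c + a, c + b[ f.
Proof.
move=> p1 /Lp_measurable mf; rewrite -(shift_itvoo a b c).
exact: (Lp_norm_comp p1 (measure_preserving_shift c) mf).
Qed.

Lemma Lp_norm_reflect p a b c f : (1 <= p)%E -> Lp p `]c - b, c - a[ f ->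
  Lp_norm p `]a, b[ (fun x => f (c - x)) = Lp_norm p `]c - b, c - a[ f.
Proof.
move=> p1 /Lp_measurable mf; rewrite -(reflect_itvoo a b c).
exact: (Lp_norm_comp p1 (measure_preserving_reflect c) mf).
Qed.

Lemma Lp_loc_itv p a b c f : (1 <= p)%E -> Lp_loc p a f -> a <= b ->
  Lp p `]b, c[ f.
Proof.
move=> p1 [_ Lf] ab.
apply: (Lp_subset (D := `]a, Num.max c (a + 1)[%classic)) => //.
  by apply: subset_itv; rewrite bnd_simp// le_max lexx.
by apply: Lf; rewrite lt_max ltrDl ltr01 orbT.
Qed.

(** The profiles chosen in the definition of the energy are replaced by f and g
    thanks to [profiles_unique]; the window ]0, 1[ in the space variable x becomes
    ]-1, 0[ by the shifts s |-> t + 1 + s for f and by a reflection followed by a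
    shift for g. *)
Lemma energy_norms p f g z t : (1 <= p)%E ->
  Lp_loc p 0 f -> Lp_loc p (-1) g -> dalembert f g z -> 0 <= t ->
  (forall r : R, p = r%:E ->
     (energy p z t `^ r =
      Zp_norm p (fun s => f (t + 1 + s)%R) `^ r +
      Zp_norm p (fun s => g (t + s)%R) `^ r)%E) /\
  (p = +oo%E ->
     energy p z t =
     maxe (Zp_norm p (fun s => f (t + 1 + s)%R))
          (Zp_norm p (fun s => g (t + s)%R))).
Proof.
move=> p1 Lf Lg fgz t0.
have : [/\ Lp_loc p 0 (profiles p z).1, Lp_loc p (-1) (profiles p z).2 &
           dalembert (profiles p z).1 (profiles p z).2 z].
  by apply: (getPex (P := [set fg | [/\ Lp_loc p 0 fg.1, Lp_loc p (-1) fg.2 &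
                    dalembert fg.1 fg.2 z]])); exists (f, g).
rewrite /energy; case: (profiles p z) => f' g' /= [Lf' Lg' fgz'].
have [ff' gg'] := profiles_unique p1 Lf Lg fgz Lf' Lg' fgz'.
have t1N1 : -1 <= t - 1 by rewrite lerBrDl subrr.
have LF : Lp p `]0, 1[ (fun x => f' (t + x)).
  by apply: Lp_shift => //; rewrite addr0; exact: Lp_loc_itv Lf' t0.
have LG : Lp p `]0, 1[ (fun x => g' (t - x)).
  by apply: Lp_reflect => //; exact: Lp_loc_itv Lg' t1N1.
have Lft := Lp_loc_itv (t + 1) p1 Lf t0; have Lft' := Lp_loc_itv (t + 1) p1 Lf' t0.
have Lgt := Lp_loc_itv t p1 Lg t1N1; have Lgt' := Lp_loc_itv t p1 Lg' t1N1.
have -> : Zp_norm p (fun s => f (t + 1 + s)) = Lp_norm p `]0, 1[ (fun x => f' (t + x)).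
  rewrite /Zp_norm !Lp_norm_shift ?addr0 ?addrK//.
  apply: eq_ae_Lp_norm => //; [exact: Lp_measurable Lft|exact: Lp_measurable Lft'|].
  apply: (ae_imp ff') => x ffx; rewrite /= in_itv/= => /andP[tx _].
  by apply: ffx; exact: le_lt_trans tx.
have -> : Zp_norm p (fun s => g (t + s)) = Lp_norm p `]0, 1[ (fun x => g' (t - x)).
  rewrite /Zp_norm Lp_norm_shift ?addr0//.
  rewrite Lp_norm_reflect ?subr0//.
  apply: eq_ae_Lp_norm => //; [exact: Lp_measurable Lgt|exact: Lp_measurable Lgt'|].
  apply: (ae_imp gg') => x ggx; rewrite /= in_itv/= => /andP[tx _].
  by apply: ggx; exact: le_lt_trans tx.
have H := Xp_norm_characteristics p1 LF LG.
by split=> [r|] pE; move: H; rewrite pE.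
Qed.

End energy_of_solutions.

(** * Gluing a sequence on unit windows *)

Section gluing.
Context {R : realType}.
Notation mu := (@lebesgue_measure R).
Implicit Types (f g h w : R -> R) (a b c x : R) (p : \bar R) (hn : nat -> R -> R).

(** The value at the common end point is required to be 0 so that the
    restriction to ]a, c[ is exactly the sum of the two restrictions. *)
Lemma Lp_cat p f a b c : (1 <= p)%E -> a < b -> b < c -> f b = 0 ->
  Lp p `]a, b[ f -> Lp p `]b, c[ f -> Lp p `]a, c[ f.
Proof.
move=> p1 ab bc fb Lab Lbc; rewrite /Lp.
have -> : f \_ `]a, c[ = (f \_ `]a, b[ + f \_ `]b, c[)%R.
  apply/funext => x; rewrite !fctE !patchE !mem_setE !in_itv/=.
  have [xb|bx|->] := ltgtP x b; rewrite ?andbF ?andbT ?addr0 ?add0r.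
  - by rewrite (lt_trans xb bc) andbT.
  - by rewrite (lt_trans ab bx).
  - by rewrite fb; case: ifP.
exact: (Lfun_addr_closed mu p1).2.
Qed.

(** On the window [n - 1, n[ the index n is the integral part of x + 1.  The
    restriction to the open interval makes the glued function vanish at the
    integers, as [Lp_cat] asks. *)
Definition glue hn x : R :=
  (hn (Num.truncn (x + 1)) \_ `]-1, 0[) (x - (Num.truncn (x + 1))%:R).

Lemma glueE hn n s : -1 < s < 0 -> glue hn (s + n%:R) = hn n s.
Proof.
move=> /andP[s1 s0]; rewrite /glue.
have -> : Num.truncn (s + n%:R + 1) = n.
  by apply: truncn_def; rewrite -natr1; lra.
by rewrite addrK patchE mem_set//= in_itv/= s1.
Qed.

Lemma glue_nat hn n : glue hn n%:R = 0.
Proof.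
rewrite /glue; have -> : Num.truncn (n%:R + 1 : R) = n.+1.
  by apply: truncn_def; rewrite natr1 lexx ltr_nat ltnS leqnn.
rewrite patchE; case: ifPn => // /set_mem /=.
by rewrite in_itv/= -natr1 opprD addNKr ltxx.
Qed.

Lemma Lp_glue p hn n : (1 <= p)%E -> (forall n, in_Zp p (hn n)) ->
  Lp p `]-1, n%:R[ (glue hn).
Proof.
move=> p1 Lh.
have L k : Lp p `]k%:R - 1, k%:R[ (glue hn).
  apply: (eq_in_Lp (f := fun x => hn k (- k%:R + x))).
    move=> x; rewrite /= in_itv/= => /andP[x0 x1].
    have xk : -1 < - k%:R + x < 0 by lra.
    by rewrite -(glueE hn k xk) addrAC addNr add0r.
  apply: Lp_shift => //; have := Lh k; rewrite /in_Zp.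
  by rewrite addrA addNr add0r.
elim: n => [|n IH]; first by have := L 0; rewrite sub0r.
apply: (Lp_cat (b := n%:R)) => //.
- by rewrite (lt_le_trans (ltrN10 _)).
- by rewrite ltr_nat.
- exact: glue_nat.
- by have := L n.+1; rewrite -natr1 addrK.
Qed.

Lemma is_Seq0_inv_glue p hn : (1 <= p)%E -> (forall n, in_Zp p (hn n)) ->
  is_Seq0_inv p hn (glue hn).
Proof.
move=> p1 Lh; split; first split.
- have -> : `]-1, +oo[%classic = \bigcup_n `]-1 : R, n%:R[%classic.
    apply/seteqP; split => x /=; rewrite in_itv/= ?andbT.
      move=> x1; exists (Num.truncn x).+1 => //=.
      by rewrite in_itv/= x1 truncnS_gt.
    by move=> [n _]; rewrite /= in_itv/= => /andP[].
  apply/measurable_fun_bigcup => // n.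
  exact: (Lp_measurable_fun _ (Lp_glue n p1 Lh)).
- move=> T _; apply: Lp_subset (Lp_glue (Num.truncn T).+1 p1 Lh) => //.
  by apply: subset_itvl; rewrite bnd_simp ltW// truncnS_gt.
- move=> n; apply: (ae_imp2 (ae_neq (-1)) (ae_neq 0)) => s s1 s0.
  rewrite /= in_itv/= => /andP[sN1 sle0]; rewrite /Seq0 glueE//.
  by rewrite !lt_neqAle sN1 sle0 eq_sym !andbT; apply/andP; split; exact/eqP.
Qed.

End gluing.

(** * Boundary conditions and initial data *)

Section reduction_to_iteration.
Context {R : realType}.
Notation mu := (@lebesgue_measure R).
Implicit Types (f g h w : R -> R) (t s : R) (p : \bar R).

(** The matrix of [rotR] is orthogonal; its inverse gives the sum and the
    difference of the travelling waves back. *)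
Lemma rotR_inverse (u d h g : R) : (g, - h) = rotR (u, - d) <->
  u = (h + g) / Num.sqrt 2 /\ d = (h - g) / Num.sqrt 2.
Proof.
have ss (x : R) : x / Num.sqrt 2 / Num.sqrt 2 = x / 2.
  by rewrite -mulrA -invfM -expr2 sqr_sqrtr.
rewrite /rotR /=; split.
  move=> [-> hE]; have -> : h = (u + d) / Num.sqrt 2.
    by rewrite -[LHS]opprK hE -mulNr opprD !opprK.
  by rewrite -mulrDl -mulrBl !ss; split; lra.
move=> [-> ->]; rewrite -!mulNr -!mulrDl !ss; congr pair; lra.
Qed.

(** Membership in a rotated set is tested by rotating back. *)
Lemma graph_rotR (Sigma : set (R * R)) (F : R -> set R) (a b : R) :
  set_graph F = [set rotR xi | xi in Sigma] ->
  F a b <-> Sigma ((a - b) / Num.sqrt 2, (a + b) / Num.sqrt 2).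
Proof.
move=> FE; have -> : F a b = set_graph F (a, b) by [].
rewrite FE; split => [[[u d] Sud]|SE].
  rewrite -[d]opprK -[b in _ = (_, b)]opprK => /esym/rotR_inverse[uE dE].
  move: Sud; rewrite -[d]opprK dE uE -mulNr opprB opprK.
  by rewrite [X in (X / _, _)]addrC.
exists ((a - b) / Num.sqrt 2, (a + b) / Num.sqrt 2) => //.
rewrite -[X in rotR (_, X)]opprK -[b in RHS]opprK; apply/esym/rotR_inverse.
by rewrite -mulNr opprD [X in _ = X / _ /\ _]addrC [- a - b]addrC.
Qed.

(** The heart of the reduction: at each time t the two boundary conditions are
    one step of the set-valued map S. *)
Lemma boundary_step (Sigma0 Sigma1 : set (R * R)) (S0 S1 : R -> set R)
    (S : R * R -> set (R * R)) f g t :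
  set_graph S0 = [set rotR xi | xi in Sigma0] ->
  set_graph S1 = [set rotR xi | xi in Sigma1] ->
  (forall x y, S (x, y) = opp_map S1 y `*` opp_map S0 x) ->
  S (f t, g (t - 1)) (f (t + 1), g t) <->
  Sigma1 (wave_t f g t 1, - wave_x f g t 1) /\
  Sigma0 (wave_t f g t 0, wave_x f g t 0).
Proof.
move=> hS0 hS1 hS; rewrite hS.
have oppE F x y : opp_map F x y <-> F x (- y).
  by split=> [[y' Fy' <-]|Fy]; [rewrite opprK|exists (- y); rewrite ?opprK].
rewrite /wave_t /wave_x addr0 subr0 -mulNr opprB.
have -> : (opp_map S1 (g (t - 1)) `*` opp_map S0 (f t)) (f (t + 1), g t) =
  (opp_map S1 (g (t - 1)) (f (t + 1)) /\ opp_map S0 (f t) (g t)) by [].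
rewrite !oppE (graph_rotR _ _ hS0) (graph_rotR _ _ hS1) !opprK.
by rewrite [g (t - 1) + f (t + 1)]addrC.
Qed.

Lemma Lp_loc_shift1 p f : (1 <= p)%E -> Lp_loc p (-1) (fun s => f (s + 1)) ->
  Lp_loc p 0 f.
Proof.
move=> p1 [mf Lf]; split.
  have -> : f = (fun s => f (s + 1)) \o (fun x => -1 + x).
    by apply/funext => x /=; rewrite addrAC addNr add0r.
  have -> : `]0, +oo[%classic = (fun x : R => -1 + x) @^-1` `]-1, +oo[.
    by apply/seteqP; split => x /=; rewrite !in_itv/= !andbT; lra.
  exact: (measurable_fun_comp_preserving (measure_preserving_shift (-1)) _ mf).
move=> T T0; apply: (eq_in_Lp (f := fun x => f (-1 + x + 1))).
  by move=> x _; rewrite addrAC addNr add0r.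
apply: (Lp_shift (f := fun s => f (s + 1))) => //; rewrite addr0; apply: Lf; lra.
Qed.

(** At time 0 the points x and -x of [0, 1] and [-1, 0] are linked: f is read on
    the first window through the shift x |-> x - 1, and g through x |-> -x. *)
Lemma solution_initial_data f g (z1 dz0 h0 g0 : R -> R) :
  (fun s => f (s + 1)) = h0 %[ae mu in `[-1, 0]%classic] ->
  g = g0 %[ae mu in `[-1, 0]%classic] ->
  {ae mu, forall s, `[0, 1]%classic s ->
     (g0 (- s), - h0 (s - 1)) = rotR (z1 s, - dz0 s)} ->
  {ae mu, forall s, `[0, 1]%classic s ->
     z1 s = wave_t f g 0 s /\ dz0 s = wave_x f g 0 s}.
Proof.
move=> fh gg I2.
have fh' := ae_shift (-1) fh.
have gg' := measure_preserving_ae (measure_preserving_reflect 0) gg.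
have fgs : {ae mu, forall s, `[0, 1]%classic s ->
    f s = h0 (s - 1) /\ g (- s) = g0 (- s)}.
  apply: (ae_imp2 fh' gg') => s; rewrite sub0r /= => fs gs.
  rewrite in_itv/= => /andP[s0 s1]; split.
    have s10 : -1 <= s - 1 <= 0 by lra.
    by move: fs; rewrite in_itv/= addrAC addNr add0r addrC => /(_ s10).
  by apply: gs; rewrite in_itv/=; lra.
apply: (ae_imp2 I2 fgs) => s I2s fgs' s01.
have [fs gs] := fgs' s01; move: (I2s s01).
by rewrite -fs -gs => /rotR_inverse[-> ->]; rewrite /wave_t /wave_x add0r sub0r.
Qed.

(** Rotate (h, g) back to get z1 and the derivative of z0, and take for z0 the
    primitive of the latter. *)
Lemma is_I2_surjective p h g : (1 <= p)%E -> in_Zp p h -> in_Zp p g ->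
  exists z0 z1, in_Xp p z0 z1 /\ is_I2 z0 z1 h g.
Proof.
move=> p1 Lh Lg.
have LF : Lp p `]0, 1[ (fun s => h (s - 1)).
  apply: (eq_in_Lp (f := fun s => h (-1 + s))); first by move=> x _; rewrite addrC.
  by apply: Lp_shift => //; rewrite addr0 addNr.
have LG : Lp p `]0, 1[ (fun s => g (- s)).
  apply: (eq_in_Lp (f := fun s => g (0 - s))); first by move=> x _; rewrite sub0r.
  by apply: Lp_reflect => //; rewrite subr0 sub0r.
pose w s := (h (s - 1) - g (- s)) / Num.sqrt 2.
have Lw : Lp p `]0, 1[ w.
  apply: eq_in_Lp (Lp_lin (Num.sqrt 2)^-1 (- (Num.sqrt 2)^-1) p1 LF LG).
  by move=> x _; rewrite /w; ring.
have [WP dP] := in_W1p_star_primitive p1 Lw.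
exists (primitive w), (fun s => (h (s - 1) + g (- s)) / Num.sqrt 2); split.
  split=> //; apply: eq_in_Lp (Lp_lin (Num.sqrt 2)^-1 (Num.sqrt 2)^-1 p1 LF LG).
  by move=> x _; ring.
by exists w => //; apply: aeW => s _; apply/rotR_inverse.
Qed.

End reduction_to_iteration.

(** * Solutions and iterated sequences *)

Section three_parts.
Context {R : realType}.
Notation mu := (@lebesgue_measure R).
Implicit Types (f g : R -> R) (z : R -> R -> R) (h gs : nat -> R -> R) (p : \bar R).

(** [boundary_step] at the time t = s + n + 1, which is nonnegative as s runs
    through [-1, 0]. *)
Lemma iterated_sequence_of_solution p (Sigma0 Sigma1 : set (R * R))
    (S0 S1 : R -> set R) (S : R * R -> set (R * R)) (z0 z1 : R -> R) z f g :
  (1 <= p)%E ->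
  set_graph S0 = [set rotR xi | xi in Sigma0] ->
  set_graph S1 = [set rotR xi | xi in Sigma1] ->
  (forall x y, S (x, y) = opp_map S1 y `*` opp_map S0 x) ->
  solution_with p Sigma0 Sigma1 z0 z1 z f g ->
  iterated_sequence p S (Seq0 (fun s => f (s + 1))) (Seq0 g).
Proof.
move=> p1 hS0 hS1 hS [[Lf Lg] _ B0 B1 _]; split=> n.
  split.
    apply: (eq_in_Lp (f := fun s => f (n%:R + 1 + s))).
      by move=> s _; rewrite /Seq0; congr f; ring.
    by apply: Lp_shift => //; apply: Lp_loc_itv Lf _ => //; rewrite addrK.
  apply: (eq_in_Lp (f := fun s => g (n%:R + s))).
    by move=> s _; rewrite /Seq0 addrC.
  by apply: Lp_shift => //; apply: Lp_loc_itv Lg _ => //; rewrite lerDr.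
apply: (ae_imp2 (ae_shift (n%:R + 1) B0) (ae_shift (n%:R + 1) B1)) => s b0 b1.
rewrite /= in_itv/= => /andP[s1 s0].
have t0 : 0 <= n%:R + 1 + s by have := ler0n R n; lra.
have := (boundary_step f g (n%:R + 1 + s) hS0 hS1 hS).2 (conj (b1 t0) (b0 t0)).
rewrite /Seq0.
have -> : n%:R + 1 + s - 1 = s + n%:R by ring.
have -> : n%:R + 1 + s + 1 = s + n.+1%:R + 1 by rewrite -natr1; ring.
have -> : n%:R + 1 + s = s + n%:R + 1 by ring.
by have -> : s + n%:R + 1 = s + n.+1%:R by rewrite -natr1; ring.
Qed.

Lemma integrable_wave_x p f g : (1 <= p)%E ->
  Lp_loc p 0 f -> Lp_loc p (-1) g ->
  mu.-integrable `]0, 1[ (EFin \o wave_x f g 0).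
Proof.
move=> p1 Lf Lg.
have LF : Lp p `]0, 1[ (fun s => f (0 + s)).
  by apply: Lp_shift => //; apply: Lp_loc_itv Lf _ => //; rewrite addr0.
have LG : Lp p `]0, 1[ (fun s => g (0 - s)).
  by apply: Lp_reflect => //; apply: Lp_loc_itv Lg _ => //; rewrite sub0r.
apply: (Lp_integrable p1) => //; first exact: lebesgue_measure_itvoo_lty.
apply: eq_in_Lp (Lp_lin (Num.sqrt 2)^-1 (- (Num.sqrt 2)^-1) p1 LF LG).
by move=> x _; rewrite /wave_x; ring.
Qed.

(** By [dalembert0] the weak derivative to exhibit for z0 is z_x at time 0. *)
Lemma is_I2_of_solution p (Sigma0 Sigma1 : set (R * R)) (z0 z1 : R -> R) z f g :
  (1 <= p)%E -> in_Xp p z0 z1 -> solution_with p Sigma0 Sigma1 z0 z1 z f g ->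
  is_I2 z0 z1 (Seq0 (fun s => f (s + 1)) 0%N) (Seq0 g 0%N).
Proof.
move=> p1 [[_ [du [lz0 _ _] _] _] _] [[Lf Lg] fgz _ _ [zz0 tz1]].
have fi y := Lp_loc_integrable y p1 Lf; have gi y := Lp_loc_integrable y p1 Lg.
have iw := integrable_wave_x p1 Lf Lg.
exists (wave_x f g 0).
  apply: eq_ae_weak_derivative (weak_derivative_primitive iw) => //.
  apply: (ae_imp zz0) => s zs s01.
  have s01' := subset_itv_oo_cc s01.
  by rewrite -zs// (dalembert0 fi gi fgz)//; move: s01'; rewrite /= in_itv.
apply: (ae_imp tz1) => s ts s01; apply/rotR_inverse.
rewrite -ts// /wave_t /wave_x /Seq0 !addr0 add0r sub0r subrK.
by split.
Qed.

(** The countably many a.e. statements, one for each step, hold simultaneously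
    outside one null set; a time t then falls into the window of its integral
    part.  The initial position is recovered from its weak derivative by
    [weak_derivative_vanishes_unique]. *)
Lemma solution_of_iterated_sequence p (Sigma0 Sigma1 : set (R * R))
    (S0 S1 : R -> set R) (S : R * R -> set (R * R)) (z0 z1 : R -> R) z f g h gs :
  (1 <= p)%E ->
  set_graph S0 = [set rotR xi | xi in Sigma0] ->
  set_graph S1 = [set rotR xi | xi in Sigma1] ->
  (forall x y, S (x, y) = opp_map S1 y `*` opp_map S0 x) ->
  iterated_sequence p S h gs ->
  is_Seq0_inv p h (fun s => f (s + 1)) -> is_Seq0_inv p gs g ->
  in_Xp p z0 z1 -> is_I2 z0 z1 (h 0%N) (gs 0%N) -> dalembert f g z ->
  solution_with p Sigma0 Sigma1 z0 z1 z f g.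
Proof.
move=> p1 hS0 hS1 hS [_ hSn] [Lf1 fh] [Lg gg] [[_ _ vz0] _] [dz0 dz0z0 I2] fgz.
have Lf := Lp_loc_shift1 p1 Lf1.
have fi y := Lp_loc_integrable y p1 Lf; have gi y := Lp_loc_integrable y p1 Lg.
have step : {ae mu, forall t, 0 <= t -> S (f t, g (t - 1)) (f (t + 1), g t)}.
  have stepn n : {ae mu, forall s, `[-1, 0]%classic s ->
      S (f (s + n%:R + 1), g (s + n%:R)) (f (s + n.+1%:R + 1), g (s + n.+1%:R))}.
    apply: (ae_imp2 (hSn n) (ae_imp2 (ae_imp2 (fh n) (fh n.+1)
      (fun s => @conj _ _)) (ae_imp2 (gg n) (gg n.+1) (fun s => @conj _ _))
      (fun s => @conj _ _))) => s Ss [[f1 f2] [g1 g2]] s01.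
    by move: (Ss s01); rewrite -f1// -f2// -g1// -g2.
  have := @ae_foralln _ _ _ mu _ (fun n => ae_shift (- (n%:R + 1)) (stepn n)).
  move=> /ae_imp; apply => t Ht t0.
  have /andP[nt tn] := truncn_itv t0; rewrite -natr1 in tn.
  have tin : `[-1, 0]%classic (- ((Num.truncn t)%:R + 1) + t).
    by rewrite /= in_itv/=; lra.
  (* s = t - (n + 1) lies in [-1, 0[ when n is the integral part of t *)
  have := Ht (Num.truncn t) tin; rewrite -natr1.
  set k := (Num.truncn t)%:R.
  have -> : - (k + 1) + t + k + 1 = t by ring.
  have -> : - (k + 1) + t + k = t - 1 by ring.
  have -> : - (k + 1) + t + (k + 1) + 1 = t + 1 by ring.
  by have -> : - (k + 1) + t + (k + 1) = t by ring.
have init := solution_initial_data (f := f) (g := g) _ _ I2.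
have fh0 : (fun s => f (s + 1)) = h 0%N %[ae mu in `[-1, 0]%classic].
  by apply: (ae_imp (fh 0)) => s H s01; rewrite -H// /Seq0 addr0.
have gg0 : g = gs 0%N %[ae mu in `[-1, 0]%classic].
  by apply: (ae_imp (gg 0)) => s H s01; rewrite -H// /Seq0 addr0.
have {fh0 gg0}init := init fh0 gg0.
split => //.
- apply: (ae_imp step) => t St t0.
  exact: ((boundary_step f g t hS0 hS1 hS).1 (St t0)).2.
- apply: (ae_imp step) => t St t0.
  exact: ((boundary_step f g t hS0 hS1 hS).1 (St t0)).1.
split; last by apply: (ae_imp init) => s H s01; have [-> _] := H s01.
have iw := integrable_wave_x p1 Lf Lg.
have dw : dz0 = wave_x f g 0 %[ae mu in `]0, 1[%classic].
  by apply: (ae_imp init) => s H s01; have [] := H (subset_itv_oo_cc s01).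
have zP := weak_derivative_vanishes_unique dz0z0 vz0 iw dw.
apply: (ae_imp2 (ae_imp2 (ae_neq 0) (ae_neq 1) (fun s => @conj _ _)) zP).
move=> s [sn0 sn1] zs; rewrite /= in_itv/= => s01.
rewrite (dalembert0 fi gi fgz)// zs//= in_itv/=; move: s01.
by rewrite !le_eqVlt => /andP[/predU1P[/esym//|->] /predU1P[//|->]].
Qed.

Lemma energy_of_iterates p f g z h gs : (1 <= p)%E ->
  Lp_loc p 0 f -> Lp_loc p (-1) g -> dalembert f g z ->
  (forall n, in_Zp p (h n) /\ in_Zp p (gs n)) ->
  (forall n, Seq0 (fun s => f (s + 1)) n = h n %[ae mu in `[-1, 0]%classic]) ->
  (forall n, Seq0 g n = gs n %[ae mu in `[-1, 0]%classic]) ->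
  forall n : nat,
  (forall r : R, p = r%:E ->
     (energy p z n%:R `^ r =
      Zp_norm p (h n) `^ r + Zp_norm p (gs n) `^ r)%E) /\
  (p = +oo%E ->
     energy p z n%:R = maxe (Zp_norm p (h n)) (Zp_norm p (gs n))).
Proof.
move=> p1 Lf Lg fgz Lh fh gg n.
have := energy_norms p1 Lf Lg fgz (ler0n R n).
have LF : Lp p `]-1, 0[ (fun s => f (n%:R + 1 + s)).
  by apply: Lp_shift => //; apply: Lp_loc_itv Lf _ => //; rewrite addrK.
have LG : Lp p `]-1, 0[ (fun s => g (n%:R + s)).
  by apply: Lp_shift => //; apply: Lp_loc_itv Lg _ => //; rewrite lerDr.
have [Lhn Lgn] := Lh n.
have -> : Zp_norm p (fun s => f (n%:R + 1 + s)) = Zp_norm p (h n).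
  apply: eq_ae_Lp_norm => //; [exact: Lp_measurable LF|exact: Lp_measurable Lhn|].
  apply: (ae_imp (fh n)) => s H s01; rewrite -H; last exact: subset_itv_oo_cc.
  by rewrite /Seq0; congr f; ring.
have -> // : Zp_norm p (fun s => g (n%:R + s)) = Zp_norm p (gs n).
apply: eq_ae_Lp_norm => //; [exact: Lp_measurable LG|exact: Lp_measurable Lgn|].
apply: (ae_imp (gg n)) => s H s01; rewrite -H; last exact: subset_itv_oo_cc.
by rewrite /Seq0 addrC.
Qed.

End three_parts.

Theorem proposition15 (R : realType) (p : \bar R) (hp : (1 <= p)%E)
    (Sigma0 Sigma1 : set (R * R)) (S0 S1 : R -> set R)
    (hS0 : set_graph S0 = [set rotR xi | xi in Sigma0])
    (hS1 : set_graph S1 = [set rotR xi | xi in Sigma1])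
    (S : R * R -> set (R * R))
    (hS : forall x y, S (x, y) = opp_map S1 y `*` opp_map S0 x) :
  (* (a) *)
  (forall (z0 z1 : R -> R) (z : R -> R -> R) (f g : R -> R),
     in_Xp p z0 z1 ->
     solution_with p Sigma0 Sigma1 z0 z1 z f g ->
     let h := Seq0 (fun s => f (s + 1)) in
     let gs := Seq0 g in
     iterated_sequence p S h gs /\ is_I2 z0 z1 (h 0%N) (gs 0%N)) /\
  (* (b) *)
  (forall h gs : nat -> R -> R,
     iterated_sequence p S h gs ->
     [/\ exists f, is_Seq0_inv p h (fun s => f (s + 1)),
         exists g, is_Seq0_inv p gs g &
         exists z0 z1, in_Xp p z0 z1 /\ is_I2 z0 z1 (h 0%N) (gs 0%N)] /\
     (forall (f g z0 z1 : R -> R) (z : R -> R -> R),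
        is_Seq0_inv p h (fun s => f (s + 1)) ->
        is_Seq0_inv p gs g ->
        in_Xp p z0 z1 -> is_I2 z0 z1 (h 0%N) (gs 0%N) ->
        dalembert f g z ->
        [/\ Lp_loc p 0 f, Lp_loc p (-1) g &
            solution p Sigma0 Sigma1 z0 z1 z])) /\
  (* (c) *)
  (forall (z : R -> R -> R) (f g : R -> R) (h gs : nat -> R -> R),
     [/\ exists z0 z1,
           in_Xp p z0 z1 /\ solution_with p Sigma0 Sigma1 z0 z1 z f g,
         h = Seq0 (fun s => f (s + 1)) &
         gs = Seq0 g] \/
     [/\ iterated_sequence p S h gs,
         is_Seq0_inv p h (fun s => f (s + 1)),
         is_Seq0_inv p gs g &
         dalembert f g z] ->
     (forall t : R, 0 <= t ->
        (forall r : R, p = r%:E ->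
           (energy p z t `^ r =
            Zp_norm p (fun s => f (t + 1 + s)%R) `^ r +
            Zp_norm p (fun s => g (t + s)%R) `^ r)%E) /\
        (p = +oo%E ->
           energy p z t =
           maxe (Zp_norm p (fun s => f (t + 1 + s)%R))
                (Zp_norm p (fun s => g (t + s)%R)))) /\
     (forall n : nat,
        (forall r : R, p = r%:E ->
           (energy p z n%:R `^ r =
            Zp_norm p (h n) `^ r + Zp_norm p (gs n) `^ r)%E) /\
        (p = +oo%E ->
           energy p z n%:R = maxe (Zp_norm p (h n)) (Zp_norm p (gs n))))).
Proof.

split; [|split].
- move=> z0 z1 z f g Xz sol h gs; split.
    exact: (iterated_sequence_of_solution hp hS0 hS1 hS sol).
  exact: (is_I2_of_solution hp Xz sol).
- move=> h gs it; have [Lhg _] := it.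
  have Lh n := (Lhg n).1; have Lg n := (Lhg n).2; split.
    split.
    + exists (fun x => glue h (x - 1)).
      rewrite (_ : (fun s => _) = glue h); first exact: is_Seq0_inv_glue.
      by apply/funext => s; rewrite addrK.
    + by exists (glue gs); exact: is_Seq0_inv_glue.
    + exact: is_I2_surjective.
  move=> f g z0 z1 z fh gg Xz I2 fgz; split.
  + exact: Lp_loc_shift1 fh.1.
  + exact: gg.1.
  + exists f, g.
    exact: (solution_of_iterated_sequence hp hS0 hS1 hS it fh gg Xz I2 fgz).
- move=> z f g h gs [[[z0 [z1 [Xz sol]]] -> ->]|[it fh gg fgz]].
    have [Lhg _] := iterated_sequence_of_solution hp hS0 hS1 hS sol.
    have [[Lf Lg] fgz _ _ _] := sol.
    split=> [t t0|n]; first exact: (energy_norms hp Lf Lg fgz t0).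
    by apply: (energy_of_iterates hp Lf Lg fgz) => // k; exact: ae_eq_refl.
  have Lf : Lp_loc p 0 f by exact: Lp_loc_shift1 fh.1.
  split=> [t t0|n]; first exact: (energy_norms hp Lf gg.1 fgz t0).
  exact: (energy_of_iterates hp Lf gg.1 fgz it.1 fh.2 gg.2).
Qed.
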